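(* Let $\mathcal{H}$ be a complex separable Hilbert space, let $U:\mathcal{H}\to\mathcal{H}$ be unitary, let $\psi\in\mathcal{H}$ with $\|\psi\|=1$, let $d\ge 1$ be an integer, and let $(\varphi_n)_{n\in A}$ be an orthonormal basis of $\mathcal{H}$ indexed by $A=\mathbb{Z}_+^d$ or $A=\mathbb{Z}^d$. Suppose that $P_{\alpha c}\psi\ne0$ for some $0\le\alpha\le1$. Then for every $p>0$, $$\tilde\beta_\psi^-(p)\ge\frac{\alpha}{d}.$$
   Context: Notation: $\mathbb{Z}_+=\{1,2,3,\dots\}$; for $n\in A$, $|n|=|n_1|+\dots+|n_d|$. $\partial\mathbb{D}=\{z\in\mathbb{C}:|z|=1\}$. Spectral measure: for $\phi\in\mathcal{H}$, $\mu_\phi$ is the finite Borel measure on $\partial\mathbb{D}$ with $\langle\phi,f(U)\phi\rangle=\int f\,d\mu_\phi$ for all bounded Borel $f$ on $\partial\mathbb{D}$. Hausdorff measure: for $\alpha\ge0$ and $E\subseteq\partial\mathbb{D}$, $h^\alpha(E)=\lim_{\delta\to0^+}\inf\sum_n(\operatorname{diam}S_n)^\alpha$, where the infimum is over countable families $(S_n)$ of subsets of $\partial\mathbb{D}$ with $\operatorname{diam}S_n<\delta$ for all $n$ and $E\subseteq\bigcup_nS_n$. A measure $\mu$ on $\partial\mathbb{D}$ is $\alpha$-continuous if $\mu(E)=0$ for all $E\subseteq \partial\mathbb{D}$ with $h^\alpha(E)=0$; it is $\alpha$-singular if it is supported on a set of zero $h^\alpha$ measure. $\mathcal{H}_{\alpha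 c}=\{\phi\in\mathcal{H}:\mu_\phi\text{ is }\alpha\text{-continuous}\}$ and $\mathcal{H}_{\alpha s}=\{\phi\in\mathcal{H}:\mu_\phi\text{ is }\alpha\text{-singular}\}$ are closed, mutually orthogonal subspaces with $\mathcal{H}=\mathcal{H}_{\alpha c}\oplus\mathcal{H}_{\alpha s}$; $P_{\alpha c}$ denotes the orthogonal projection onto $\mathcal{H}_{\alpha c}$. Dynamics: $\psi(k)=U^k\psi$, $a_\psi(n,k)=|\langle\varphi_n,\psi(k)\rangle|^2$, $|X|^p_\psi(k)=\sum_{n\in A}(|n|^p+1)\,a_\psi(n,k)\in[1,\infty]$, and for integers $K\ge1$, $\langle|X|^p_\psi\rangle(K)=\frac1K\sum_{k=0}^{K-1}|X|^p_\psi(k)$. The lower time-averaged transport exponent is $$\tilde\beta_\psi^-(p)=\liminf_{K\to\infty}\frac{\log\big(\langle|X|^p_\psi\rangle(K)\big)}{p\log K}.$$ *)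

(* Defs.v *)
From HB Require Import structures.
From mathcomp Require Import all_boot all_order all_algebra.
From mathcomp Require Import complex.
From mathcomp Require Import all_classical all_reals all_analysis.

Set Implicit Arguments.
Unset Strict Implicit.
Unset Printing Implicit Defensive.

Import Order.TTheory GRing.Theory Num.Theory.
Import numFieldNormedType.Exports.

Local Open Scope classical_set_scope.
Local Open Scope ring_scope.
Local Open Scope complex_scope.

(* [hilbert_dot] follows the library convention: linear in its FIRST argument,
   conjugate-linear in the second. *)
HB.mixin Record isHilbert (R : realType) (H : Type)
    of CompleteNormedModule R[i] H := {
  hilbert_dot : {dot H for (@Num.conj_op R[i])};
  hilbert_dot_norm : forall x : H, `|x| ^+ 2 = hilbert_dot x x
}.

#[short(type="hilbertType")]
HB.structure Definition Hilbert (R : realType) :=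
  {H of isHilbert R H & CompleteNormedModule R[i] H}.

(* The bracket <x, y> used below is linear in its SECOND argument, as forced by
   <x, f(U) x> = \int f d mu_x. *)
Definition inner (R : realType) (H : hilbertType R) (x y : H) : R[i] :=
  hilbert_dot y x.

Definition separable (T : topologicalType) : Prop :=
  exists2 D : set T, countable D & dense D.

Section hilbert.
Context {R : realType} {H : hilbertType R}.

Definition unitary (U : H -> H) : Prop :=
  [/\ linear U, forall y, exists x, U x = y &
      forall x y, inner (U x) (U y) = inner x y].

Definition bounded_linear (T : H -> H) : Prop :=
  linear T /\ exists M : R, forall x, `|T x| <= M%:C * `|x|.

Definition orthonormal_basis (I : choiceType) (A : set I) (phi : I -> H) :
    Prop :=
  (forall m n, A m -> A n -> inner (phi m) (phi n) = (m == n)%:R) /\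
  dense [set x : H | exists (s : seq I) (c : I -> R[i]),
    (forall i, i \in s -> A i) /\ x = \sum_(i <- s) c i *: phi i].

(* Orthogonal projection of x onto S; the default value 0 is only returned
   when x has no orthogonal projection onto S, which does not happen for a
   closed subspace. *)
Definition orth_proj (S : set H) (x : H) : H :=
  xget 0 [set y | S y /\ forall z, S z -> inner z (x - y) = 0].

End hilbert.

Section circle.
Context (R : realType).

Definition unit_circle : set R[i]^o := [set z | `|z| = 1].

Definition circle : Type := unit_circle.

HB.instance Definition _ := Topological.on circle.

Definition circle_val (z : circle) : R[i] := set_val z.

Lemma circle1_subproof : (1 : R[i]^o) \in unit_circle.
Proof. by rewrite inE /unit_circle /= normr1. Qed.

HB.instance Definition _ :=
  isPointed.Build circle (exist _ (1 : R[i]^o) circle1_subproof).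

Definition borel_circle := g_sigma_algebraType (@open circle).

(* [R[i]] carries no measurable structure in the library: a complex function is
   Borel when its real and imaginary parts are. *)
Definition bounded_borel (f : borel_circle -> R[i]) : Prop :=
  [/\ measurable_fun setT (fun z => complex.Re (f z)),
      measurable_fun setT (fun z => complex.Im (f z)) &
      exists M : R, forall z, `|f z| <= M%:C].

Definition cintegral (mu : {measure set borel_circle -> \bar R})
    (f : borel_circle -> R[i]) : R[i] :=
  (\int[mu]_z complex.Re (f z)) +i* (\int[mu]_z complex.Im (f z)).

End circle.

Section spectral.
Context {R : realType} {H : hilbertType R}.

(* F is the Borel functional calculus f |-> f(U): the map from bounded Borel
   functions on the circle to bounded operators that is a unital
   *-homomorphism, sends the function z to U, and turns bounded pointwise
   convergence into strong convergence. By the spectral theorem it exists, and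
   its values on bounded Borel functions are uniquely determined, for every
   unitary U. *)
Record borel_calculus (U : H -> H) (F : (borel_circle R -> R[i]) -> H -> H) :
    Prop := BorelCalculus {
  calculus_bounded : forall f, bounded_borel f -> bounded_linear (F f);
  calculus_linear : forall (c : R[i]) f g, bounded_borel f -> bounded_borel g ->
    forall x, F (fun z => c * f z + g z) x = c *: F f x + F g x;
  calculus_mul : forall f g, bounded_borel f -> bounded_borel g ->
    forall x, F (fun z => f z * g z) x = F f (F g x);
  calculus_conj : forall f, bounded_borel f ->
    forall x y, inner (F f x) y = inner x (F (fun z => (f z)^*) y);
  calculus_one : forall x, F (fun=> 1) x = x;
  calculus_id : forall x, F (@circle_val R) x = U x;
  calculus_cvg : forall (f_ : nat -> borel_circle R -> R[i]) f (M : R),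
    (forall n, bounded_borel (f_ n)) -> bounded_borel f ->
    (forall n z, `|f_ n z| <= M%:C) ->
    (forall z, (f_ n z : R[i]^o) @[n --> \oo] --> (f z : R[i]^o)) ->
    forall x, F (f_ n) x @[n --> \oo] --> F f x
}.

Definition spectral_measure (U : H -> H) (x : H)
    (mu : {finite_measure set (borel_circle R) -> \bar R}) : Prop :=
  exists F, borel_calculus U F /\
    forall f, bounded_borel f -> inner x (F f x) = cintegral mu f.

End spectral.

Section hausdorff.
Context {R : realType}.
Local Open Scope ereal_scope.

Definition diam (S : set (circle R)) : R :=
  sup [set ComplexField.Normc.normc (circle_val x - circle_val y)%R
      | x in S & y in S].

(* Covers are indexed by an arbitrary set J of naturals, so that finite (and
   empty) families are allowed. This matters for a = 0, where 0 `^ 0 = 1. *)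
Definition hausdorff_pre (a : R) (E : set (circle R)) (delta : R) : \bar R :=
  ereal_inf [set s | exists (J : set nat) (S : nat -> set (circle R)),
    [/\ forall n, J n -> (diam (S n) < delta)%R,
        E `<=` \bigcup_(n in J) S n &
        s = \esum_(n in J) (diam (S n) `^ a)%:E]].

Definition hausdorff_measure (a : R) (E : set (circle R)) : \bar R :=
  lim (hausdorff_pre a E delta @[delta --> (0 : R)^'+]).

(* mu is only defined on Borel sets; for an arbitrary E, mu(E) = 0 is read in
   the completion of mu. *)
Definition alpha_continuous (a : R)
    (mu : {finite_measure set (borel_circle R) -> \bar R}) : Prop :=
  forall E : set (circle R), hausdorff_measure a E = 0 -> mu.-negligible E.

End hausdorff.

Definition pos_lattice (d : nat) : set {ffun 'I_d -> int} :=
  [set n | forall i, 0 < n i].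

Arguments pos_lattice : clear implicits.

Definition index_norm (d : nat) (n : {ffun 'I_d -> int}) : nat :=
  (\sum_(i < d) `|n i|)%N.

Section transport.
Context {R : realType} {H : hilbertType R}.

Definition H_ac (U : H -> H) (a : R) : set H :=
  [set x | exists mu, spectral_measure U x mu /\ alpha_continuous a mu].

Definition P_ac (U : H -> H) (a : R) : H -> H := orth_proj (H_ac U a).

Variables (U : H -> H) (d : nat) (A : set {ffun 'I_d -> int}).
Variables (phi : {ffun 'I_d -> int} -> H) (psi : H).

Definition site_prob (n : {ffun 'I_d -> int}) (k : nat) : R :=
  ComplexField.Normc.normc (inner (phi n) (iter k U psi)) ^+ 2.

Definition moment (p : R) (k : nat) : \bar R :=
  \esum_(n in A) ((((index_norm n)%:R `^ p + 1) * site_prob n k)%:E).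

Definition avg_moment (p : R) (K : nat) : \bar R :=
  ((K%:R^-1)%:E * \sum_(0 <= k < K) moment p k)%E.

Definition beta_lower (p : R) : \bar R :=
  limn_einf (fun K => (lne (avg_moment p K) * ((p * ln K%:R)^-1)%:E)%E).

End transport.

(* Main.v *)
Require Import Defs.
From mathcomp Require Import all_boot all_order all_algebra.
From mathcomp Require Import complex ring lra zify.
From mathcomp Require Import all_classical all_reals all_analysis.
From mathcomp Require Import measurable_realfun.

Import Order.TTheory GRing.Theory Num.Theory.
Import numFieldNormedType.Exports.
Import ComplexField.Normc.

(** Let [y] be the projection of [psi] on the [alpha]-continuous subspace and [mu] its
    spectral measure; then [inner y psi = sqnorm y > 0]. The theorem holds because a
    vector whose spectral measure is spread out cannot keep returning to the same
    sites: averaged over the times [k < K], its probability on any given site is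
    small, so it can only be accommodated by a large box of sites, and [psi] has to
    follow it since their overlap is invariant under [U].

    First, [alpha]-continuity is made quantitative. The circle is cut into dyadic
    cells of diameter about [2 ^- j]. For [a < alpha], call a cell heavy when its mass
    exceeds [2 `^ (- a * j)]. Heavy cells of all scales beyond [J] have small total
    [alpha]-dimensional content, so the points lying in infinitely many of them form
    a set of zero Hausdorff measure, which [mu] does not charge. Removing a set of
    small mass thus leaves a set [S] that meets only light cells at all fine scales
    ([large_regular_set]), and the restriction [x] of [y] to the spectral set [S] still
    overlaps with [psi] ([regular_vector]). Giving up an arbitrarily small part of the
    exponent is harmless for the conclusion.

    Secondly, for [K] of order [2 ^ j], the sum over [k < K] of the squared overlaps of
    [iter k U x] with any vector [z] is at most a constant times
    [2 ^ j * (j + 3) * 2 `^ (- a * j) * sqnorm z] ([spectral_sieve]). By duality this is a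
    bound for the integral over [S] of a squared trigonometric polynomial of degree less
    than [K]. Light cells reduce the integral to a sum over one point per cell
    ([sieve_integral]), and that sum is bounded by the large sieve inequality, which
    follows by a second duality from the decay of the Dirichlet kernel
    ([large_sieve]).

    Finally, take a box of radius about [2 `^ (j * b)] with [b * d < a]. The averaged mass
    of [iter k U x] in the box tends to 0, hence a fixed proportion of the mass of
    [iter k U psi] lies outside the box on average ([avg_moment_ge]), and the averaged
    moments are at least a constant times [2 `^ (j * b * p)]. Taking logarithms gives the
    exponent [b], which is arbitrarily close to [alpha / d]
    ([beta_lower_ge_of_sieve]). *)

Local Open Scope classical_set_scope.
Local Open Scope ring_scope.
Local Open Scope complex_scope.

(** * Complex scalars and the squared norm of a Hilbert space *)

Section scalars.
Context {R : realType}.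
Implicit Types (x y z : R[i]).

Lemma norm_normcE z : `|z| = (normc z)%:C.
Proof. by []. Qed.

Lemma normc_ge0 z : 0 <= normc z.
Proof. by case: z => a b /=; apply: sqrtr_ge0. Qed.

Lemma normc_sqrE z : normc z ^+ 2 = complex.Re z ^+ 2 + complex.Im z ^+ 2.
Proof. by case: z => a b /=; rewrite sqr_sqrtr // addr_ge0 // sqr_ge0. Qed.

Lemma conj_mulE z : conjc z * z = (normc z ^+ 2)%:C.
Proof.
rewrite normc_sqrE; case: z => a b /=; apply/eqP.
by rewrite eq_complex /=; apply/andP; split; apply/eqP; ring.
Qed.

Lemma normc_conj z : normc (conjc z) = normc z.
Proof. by case: z => a b /=; rewrite sqrrN. Qed.

Lemma normc_sum (I : Type) (s : seq I) (P : pred I) (f : I -> R[i]) :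
  normc (\sum_(i <- s | P i) f i) <= \sum_(i <- s | P i) normc (f i).
Proof.
elim/big_rec2: _ => [|i a b _ h]; first by rewrite normc0.
by apply: (le_trans (le_normcD _ _)); rewrite lerD2l.
Qed.

Lemma Re_sum (I : Type) (s : seq I) (P : pred I) (f : I -> R[i]) :
  complex.Re (\sum_(i <- s | P i) f i) = \sum_(i <- s | P i) complex.Re (f i).
Proof.
elim/big_rec2: _ => [//|i a b _ <-].
by case: (f i) => u v; case: b.
Qed.

Lemma real_complex_sum (I : Type) (s : seq I) (P : pred I) (f : I -> R) :
  (\sum_(i <- s | P i) f i)%:C = \sum_(i <- s | P i) (f i)%:C :> R[i].
Proof. exact: raddf_sum. Qed.

End scalars.

Section hilbert_facts.
Context {R : realType} {H : hilbertType R}.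
Implicit Types (x y z : H).

(** The norm of the space takes values in [R[i]]; this real-valued square lets all
    the estimates below live in [R]. *)
Definition sqnorm x : R := complex.Re (inner x x).

Lemma innerDl x y z : inner (x + y) z = inner x z + inner y z.
Proof. exact: linearDr. Qed.
Lemma innerDr x y z : inner z (x + y) = inner z x + inner z y.
Proof. exact: linearDl. Qed.
Lemma innerBl x y z : inner (x - y) z = inner x z - inner y z.
Proof. exact: linearBr. Qed.
Lemma innerBr x y z : inner z (x - y) = inner z x - inner z y.
Proof. exact: linearBl. Qed.
Lemma innerZl (a : R[i]) x y : inner (a *: x) y = conjc a * inner x y.
Proof. exact: linearZr_LR. Qed.
Lemma innerZr (a : R[i]) x y : inner x (a *: y) = a * inner x y.
Proof. exact: linearZl_LR. Qed.
Lemma inner_suml (I : Type) (s : seq I) (P : pred I) (f : I -> H) y :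
  inner (\sum_(i <- s | P i) f i) y = \sum_(i <- s | P i) inner (f i) y.
Proof. exact: linear_sumr. Qed.
Lemma inner_sumr (I : Type) (s : seq I) (P : pred I) (f : I -> H) y :
  inner y (\sum_(i <- s | P i) f i) = \sum_(i <- s | P i) inner y (f i).
Proof. exact: linear_sumlz. Qed.
Lemma innerC x y : inner x y = conjc (inner y x).
Proof. by rewrite /inner hermC expr0 mul1r. Qed.

Lemma innerxx x : inner x x = (sqnorm x)%:C.
Proof.
rewrite /sqnorm RRe_real //; apply: ger0_real; exact: dnorm_ge0.
Qed.

Lemma sqnorm_ge0 x : 0 <= sqnorm x.
Proof. by rewrite -ler0c -innerxx; exact: dnorm_ge0. Qed.

Lemma sqnorm_gt0 x : x != 0 -> 0 < sqnorm x.
Proof. by move=> x0; rewrite -ltcR -innerxx; rewrite /inner dnorm_gt0. Qed.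

Lemma norm_sqnorm x : `|x| ^+ 2 = (sqnorm x)%:C.
Proof. by rewrite hilbert_dot_norm -innerxx. Qed.

Lemma sqnormD x y : sqnorm (x + y) = sqnorm x + sqnorm y + 2 * complex.Re (inner x y).
Proof.
rewrite /sqnorm !innerDl !innerDr [inner y x]innerC.
case: (inner x x) (inner x y) (inner y y) => [a b] [c d] [e f] /=; ring.
Qed.

Lemma sqnormZ (a : R[i]) x : sqnorm (a *: x) = normc a ^+ 2 * sqnorm x.
Proof.
rewrite /sqnorm innerZl innerZr mulrA conj_mulE innerxx -rmorphM //.
Qed.

Lemma inner0l y : inner (0 : H) y = 0.
Proof. exact: linear0r. Qed.
Lemma inner0r y : inner y (0 : H) = 0.
Proof. exact: linear0l. Qed.

Lemma cauchy_schwarz x y : normc (inner x y) ^+ 2 <= sqnorm x * sqnorm y.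
Proof.
have [->|y0] := eqVneq y 0.
  by rewrite inner0r normc0 expr0n /= mulr_ge0 // sqnorm_ge0.
have b0 := sqnorm_gt0 _ y0.
(* up to the factor [sqnorm y], the component of [x] orthogonal to [y] *)
have := sqnorm_ge0 ((sqnorm y)%:C *: x + (- inner y x) *: y).
rewrite sqnormD !sqnormZ innerZl innerZr conjc_real [inner y x]innerC.
rewrite normcN normc_conj.
have -> : complex.Re ((sqnorm y)%:C * (- conjc (inner x y) * inner x y)) =
   - (sqnorm y * normc (inner x y) ^+ 2).
  by rewrite mulNr conj_mulE mulrN -rmorphM.
have -> : normc (sqnorm y)%:C = sqnorm y.
  by rewrite /= expr0n addr0 sqrtr_sqr ger0_norm // ltW.
move=> h; rewrite -(ler_pM2l b0); nra.
Qed.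

End hilbert_facts.

(** * Finite sums and duality *)

Section finite_sums.
Context {R : realType}.

Lemma cauchy_schwarz_sum (I : finType) (x y : I -> R) :
  (\sum_i x i * y i) ^+ 2 <= (\sum_i x i ^+ 2) * (\sum_i y i ^+ 2).
Proof.
set X := \sum_i x i ^+ 2; set Y := \sum_i y i ^+ 2; set P := \sum_i _.
have Y0 : 0 <= Y by apply: sumr_ge0 => i _; exact: sqr_ge0.
have [Yz|Ynz] := eqVneq Y 0.
  have yz i : y i = 0.
    apply/eqP; rewrite -sqrf_eq0 eq_le sqr_ge0 andbT -Yz.
    by rewrite /Y (bigD1 i) //= lerDl; apply: sumr_ge0 => j _; exact: sqr_ge0.
  have -> : P = 0 by apply: big1 => i _; rewrite yz mulr0.
  by rewrite Yz mulr0 expr0n.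
have Yp : 0 < Y by rewrite lt_def Ynz.
have : 0 <= \sum_i (Y * x i - P * y i) ^+ 2.
  by apply: sumr_ge0 => i _; exact: sqr_ge0.
have -> : \sum_i (Y * x i - P * y i) ^+ 2 = Y * (Y * X - P ^+ 2).
  have -> : Y * (Y * X - P ^+ 2) =
      Y ^+ 2 * X - (2 * Y * P) * P + P ^+ 2 * Y by ring.
  have EX t : t * X = \sum_i t * x i ^+ 2 by exact: mulr_sumr.
  have EP t : t * P = \sum_i t * (x i * y i) by exact: mulr_sumr.
  have EY t : t * Y = \sum_i t * y i ^+ 2 by exact: mulr_sumr.
  rewrite EX (EP (2 * Y * P)) (EY (P ^+ 2)) -sumrB -big_split /=.
  by apply: eq_bigr => i _; ring.
by rewrite pmulr_rge0 // subr_ge0 mulrC.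
Qed.

Lemma cauchy_schwarz_sumc (I : finType) (c d : I -> R[i]) :
  normc (\sum_i c i * d i) ^+ 2 <=
  (\sum_i normc (c i) ^+ 2) * (\sum_i normc (d i) ^+ 2).
Proof.
apply: le_trans (cauchy_schwarz_sum _ _ _).
rewrite lerXn2r ?nnegrE ?normc_ge0 //.
  by apply: sumr_ge0 => i _; rewrite mulr_ge0 // normc_ge0.
apply: le_trans (normc_sum _ _ _ _) _.
by apply: ler_sum => i _; rewrite normcM.
Qed.

(** The absorption step that ends both duality arguments: a quantity bounded by
    the square root of [B] times itself cancels against itself. *)
Lemma le_of_sqr_le (X Y B : R) : 0 <= X -> 0 <= Y -> 0 <= B ->
  X ^+ 2 <= (B * X) * Y -> X <= B * Y.
Proof.
move=> X0 Y0 B0 h; have [->|Xn] := eqVneq X 0; first by rewrite mulr_ge0.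
have Xp : 0 < X by rewrite lt_def Xn.
by rewrite -(ler_pM2l Xp) -expr2 mulrCA mulrA.
Qed.

(** A matrix and its adjoint have the same operator norm, so the values of
    [c |-> (\sum_k c k * a r k)_r] are controlled by the Gram matrix of the rows
    of [a]; Schur's test bounds the latter by its largest absolute row sum. *)
Lemma schur_duality (I J : finType) (a : I -> J -> R[i]) (L : R) : 0 <= L ->
  (forall r, \sum_s normc (\sum_k a r k * conjc (a s k)) <= L) ->
  forall c : J -> R[i],
  \sum_r normc (\sum_k c k * a r k) ^+ 2 <= L * \sum_k normc (c k) ^+ 2.
Proof.
move=> L0 hL c; pose u r := \sum_k c k * a r k.
pose G r s := \sum_k a r k * conjc (a s k).
pose d k := \sum_r conjc (u r) * a r k.
set X := \sum_r _; set Y := \sum_k normc (c k) ^+ 2.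
have X0 : 0 <= X by apply: sumr_ge0 => r _; exact: sqr_ge0.
have Y0 : 0 <= Y by apply: sumr_ge0 => r _; exact: sqr_ge0.
have EX : X%:C = \sum_k c k * d k.
  rewrite real_complex_sum.
  under eq_bigr do rewrite -conj_mulE -/(u _) {2}/u mulr_sumr.
  rewrite exchange_big /=; apply: eq_bigr => k _.
  rewrite /d mulr_sumr; apply: eq_bigr => r _; ring.
have Gsym r s : normc (G s r) = normc (G r s).
  rewrite -normc_conj rmorph_sum /=; congr normc; apply: eq_bigr => k _.
  by rewrite rmorphM /= conjcK mulrC.
have Ed : (\sum_k normc (d k) ^+ 2)%:C =
    \sum_r \sum_s conjc (u r) * u s * G r s.
  rewrite real_complex_sum.
  transitivity (\sum_k \sum_r \sum_s
      conjc (u r) * u s * (a r k * conjc (a s k))).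
    apply: eq_bigr => k _; rewrite -conj_mulE mulrC {1}/d mulr_suml.
    apply: eq_bigr => r _; rewrite [conjc (d k)]rmorph_sum mulr_sumr.
    by apply: eq_bigr => s _; rewrite rmorphM /= conjcK; ring.
  rewrite exchange_big /=; apply: eq_bigr => r _.
  by rewrite exchange_big /=; apply: eq_bigr => s _; rewrite /G mulr_sumr.
have Bd : \sum_k normc (d k) ^+ 2 <= L * X.
  rewrite -[leLHS](@ger0_norm _) ?sumr_ge0 // => [|k _]; last exact: sqr_ge0.
  have -> (t : R) : `|t| = normc t%:C by rewrite /= expr0n addr0 sqrtr_sqr.
  rewrite Ed; apply: le_trans (normc_sum _ _ _ _) _.
  apply: (@le_trans _ _ (\sum_r \sum_s
     (normc (u r) ^+ 2 + normc (u s) ^+ 2) / 2 * normc (G r s))).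
    apply: ler_sum => r _; apply: le_trans (normc_sum _ _ _ _) _.
    apply: ler_sum => s _; rewrite !normcM normc_conj.
    apply: ler_wpM2r; first exact: normc_ge0.
    have := sqr_ge0 (normc (u r) - normc (u s)); nra.
  have -> : \sum_r \sum_s
     (normc (u r) ^+ 2 + normc (u s) ^+ 2) / 2 * normc (G r s) =
     \sum_r normc (u r) ^+ 2 * \sum_s normc (G r s).
    transitivity (\sum_r \sum_s normc (u r) ^+ 2 / 2 * normc (G r s) +
        \sum_r \sum_s normc (u s) ^+ 2 / 2 * normc (G r s)).
      rewrite -big_split; apply: eq_bigr => r _; rewrite -big_split /=.
      by apply: eq_bigr => s _; ring.
    rewrite [X in _ + X]exchange_big -big_split; apply: eq_bigr => r _ /=.
    rewrite -big_split mulr_sumr; apply: eq_bigr => s _ /=.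
    by rewrite (Gsym r s); field.
  rewrite /X mulr_sumr; apply: ler_sum => r _; rewrite mulrC.
  by apply: ler_wpM2r; [exact: sqr_ge0 | exact: hL].
apply: le_of_sqr_le => //.
have -> : X ^+ 2 = normc X%:C ^+ 2 by rewrite normc_sqrE /= expr0n addr0.
rewrite EX; apply: le_trans (cauchy_schwarz_sumc _ _ _) _.
by rewrite mulrC; apply: ler_wpM2r.
Qed.

End finite_sums.

Section hilbert_sums.
Context {R : realType} {H : hilbertType R}.

(** Same principle as [schur_duality], between [H] and the finite index set:
    the adjoint of [c |-> \sum_k c k *: v k] is [x |-> (inner (v k) x)_k]. *)
Lemma hilbert_duality (J : finType) (v : J -> H) (B : R) : 0 <= B ->
  (forall c : J -> R[i],
     sqnorm (\sum_k c k *: v k) <= B * \sum_k normc (c k) ^+ 2) ->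
  forall x, \sum_k normc (inner x (v k)) ^+ 2 <= B * sqnorm x.
Proof.
move=> B0 hB x; set X := \sum_k _.
have X0 : 0 <= X by apply: sumr_ge0 => r _; exact: sqr_ge0.
pose c k := conjc (inner x (v k)).
have EX : X%:C = inner x (\sum_k c k *: v k).
  rewrite inner_sumr real_complex_sum; apply: eq_bigr => k _.
  by rewrite innerZr conj_mulE.
apply: le_of_sqr_le => //; first exact: sqnorm_ge0.
have -> : X ^+ 2 = normc X%:C ^+ 2 by rewrite normc_sqrE /= expr0n addr0.
rewrite EX; apply: le_trans (cauchy_schwarz _ _) _.
rewrite mulrC ler_wpM2r ?sqnorm_ge0 //.
apply: le_trans (hB _) _; rewrite ler_wpM2l // /X le_eqVlt.
by apply/orP; left; apply/eqP/eq_bigr => k _; rewrite normc_conj.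
Qed.

End hilbert_sums.

(** * The large sieve for separated points of the circle *)

Section large_sieve.
Context {R : realType}.

Lemma normcX (z : R[i]) k : normc (z ^+ k) = normc z ^+ k.
Proof.
elim: k => [|k IH]; first by rewrite !expr0 normc1.
by rewrite !exprS normcM IH.
Qed.

(** With [u = z * conjc w] this is the geometric series: [(u - 1)] times the sum is
    [u ^+ K - 1], and [u - 1] has the same modulus as [z - w]. *)
Lemma dirichlet_kernel_le (z w : R[i]) K : normc z = 1 -> normc w = 1 ->
  normc (z - w) * normc (\sum_(k < K) z ^+ k * conjc (w ^+ k)) <= 2.
Proof.
move=> z1 w1; pose u := z * conjc w.
have u1 : normc u = 1 by rewrite normcM normc_conj z1 w1 mulr1.
have -> : normc (z - w) = normc (u - 1).
  have -> : u - 1 = (z - w) * conjc w.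
    have := conj_mulE w; rewrite w1 expr1n => e; rewrite mulrBl -/u.
    by rewrite [w * _]mulrC e.
  by rewrite normcM normc_conj w1 mulr1.
have -> : \sum_(k < K) z ^+ k * conjc (w ^+ k) = \sum_(k < K) u ^+ k.
  by apply: eq_bigr => k _; rewrite rmorphXn exprMn.
rewrite -normcM -subrX1; apply: le_trans (le_normcD _ _) _.
by rewrite normcX u1 expr1n normcN normc1.
Qed.

Lemma dirichlet_kernel_le_size (z w : R[i]) K : normc z = 1 -> normc w = 1 ->
  normc (\sum_(k < K) z ^+ k * conjc (w ^+ k)) <= K%:R.
Proof.
move=> z1 w1; apply: le_trans (normc_sum _ _ _ _) _.
rewrite (eq_bigr (fun=> 1)) => [|k _].
  by rewrite sumr_const card_ord.
by rewrite normcM normc_conj !normcX z1 w1 !expr1n mulr1.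
Qed.

Definition harmonic_sum n : R := \sum_(0 <= d < n) (d%:R + 1)^-1.

Lemma harmonic_sum_ge0 n : 0 <= harmonic_sum n.
Proof. by apply: sumr_ge0 => d _; rewrite invr_ge0 addr_ge0. Qed.

Lemma harmonic_sum_mono m n : (m <= n)%N -> harmonic_sum m <= harmonic_sum n.
Proof.
move=> mn; rewrite /harmonic_sum [leRHS](@big_cat_nat _ _ _ m) //= lerDl.
by apply: sumr_ge0 => d _; rewrite invr_ge0 addr_ge0.
Qed.

(** Each dyadic block of the harmonic series contributes at most 1. *)
Lemma harmonic_sum_exp2 m : harmonic_sum (2 ^ m) <= m%:R + 1.
Proof.
elim: m => [|m IH].
  by rewrite expn0 /harmonic_sum big_nat1 mulr0n !add0r invr1.
rewrite /harmonic_sum (@big_cat_nat _ _ _ (2 ^ m)%N) ?leq_exp2l //=.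
rewrite -natr1; apply: lerD; first exact: IH.
apply: (@le_trans _ _ (\sum_(2 ^ m <= d < 2 ^ m.+1) (2 ^ m)%:R^-1 : R)).
  apply: ler_sum_nat => d /andP[md _].
  rewrite lef_pV2 ?posrE ?ltr0n ?expn_gt0 ?ltr_wpDl //.
  by apply: le_trans (_ : d%:R <= _); rewrite ?ler_nat ?lerDl.
rewrite sumr_const_nat expnS mul2n -addnn addnK -[leLHS]mulr_natr mulVf //.
Qed.

Lemma harmonic_distance_sum n (r : nat) : (r < n)%N ->
  \sum_(0 <= s < n) (`|r%:R - s%:R| + 1)^-1 <= 2 * harmonic_sum n.
Proof.
move=> rn; rewrite (@big_cat_nat _ _ _ r) ?(ltnW rn) //= mulr_natl mulr2n.
apply: lerD.
  rewrite big_nat_rev /= add0n.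
  apply: le_trans (harmonic_sum_mono _ _ (ltnW rn)).
  apply: ler_sum_nat => s /andP[_ sr].
  rewrite natrB // opprB addrCA subrr addr0 ger0_norm // -natr1.
  rewrite lef_pV2 ?posrE ?ltr_wpDl ?addr_ge0 // lerD2r lerDl //.
rewrite -{1}[r]add0n big_addn.
apply: le_trans (harmonic_sum_mono _ _ (leq_subr r n)).
apply: ler_sum_nat => s _.
by rewrite natrD opprD addrCA subrr addr0 normrN ger0_norm.
Qed.

(** The large sieve inequality, up to a logarithm, for points separated at scale
    [1 / N] along an indexing by an interval of integers. By [schur_duality] it
    is enough to sum the Dirichlet kernel over the points; it decays like the
    inverse of the distance, hence the harmonic sum. The predicate [P] allows for
    indices that carry no point. *)
Lemma large_sieve (n N K : nat) (P : pred 'I_n) (z : 'I_n -> R[i])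
    (c : 'I_K -> R[i]) : (K <= 2 * N)%N ->
  (forall r, P r -> normc (z r) = 1) ->
  (forall r s, P r -> P s ->
     `|(r : nat)%:R - (s : nat)%:R| - 1 <= N%:R * normc (z r - z s)) ->
  \sum_(r | P r) normc (\sum_k c k * z r ^+ k) ^+ 2 <=
  16 * N%:R * harmonic_sum n * \sum_k normc (c k) ^+ 2.
Proof.
move=> KN z1 sep.
pose a (r : 'I_n) (k : 'I_K) := if P r then z r ^+ k else 0.
have L0 : 0 <= 16 * N%:R * harmonic_sum n.
  by rewrite !mulr_ge0 ?harmonic_sum_ge0.
have := @schur_duality R _ _ a _ L0 => /(_ _ c) h.
apply: le_trans (h _).
  rewrite big_mkcond; apply: ler_sum => r _; case: ifP => [Pr|_].
    by rewrite /a Pr.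
  exact: sqr_ge0.
move=> r; have [Pr|nPr] := boolP (P r); last first.
  rewrite big1 // => s _; rewrite big1 ?normc0 // => k _.
  by rewrite /a (negbTE nPr) mul0r.
(* the kernel between points at index distance [t] is at most [2 * N], and at most
   [2 * N / (t - 1)] when [1 < t]; the smaller of the two
   is at most [8 * N / (t + 1)] *)
apply: (@le_trans _ _ (\sum_(s < n)
    8 * N%:R * (`|(r : nat)%:R - (s : nat)%:R| + 1)^-1)).
  apply: ler_sum => s _; have [Ps|nPs] := boolP (P s); last first.
    rewrite big1 ?normc0; last first.
      by move=> k _; rewrite /a (negbTE nPs) conjc0 mulr0.
    by rewrite mulr_ge0 // ?mulr_ge0 // invr_ge0 addr_ge0.
  rewrite /a Pr Ps; set t := `|_ - _|; set D := normc _.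
  have t0 : 0 <= t by exact: normr_ge0.
  have D1 : D <= K%:R := dirichlet_kernel_le_size _ _ _ (z1 _ Pr) (z1 _ Ps).
  have D2 := dirichlet_kernel_le _ _ K (z1 _ Pr) (z1 _ Ps).
  rewrite -/D in D2; have := sep _ _ Pr Ps; rewrite -/t => D3.
  have D0 : 0 <= D by exact: normc_ge0.
  have KN' : K%:R <= 2 * N%:R :> R by rewrite -natrM ler_nat.
  have N0 : 0 <= N%:R :> R by [].
  rewrite ler_pdivlMr ?ltr_wpDl //.
  have : D * (t - 1) <= 2 * N%:R.
    have [t1|t1] := leP t 1.
      by apply: (@le_trans _ _ 0); [nra | rewrite mulr_ge0].
    apply: (@le_trans _ _ (D * (N%:R * normc (z r - z s)))).
      by rewrite ler_wpM2l.
    rewrite mulrCA [D * _]mulrC [2 * _]mulrC; exact: ler_wpM2l.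
  nra.
rewrite -mulr_sumr -(big_mkord predT (fun s : nat =>
  (`|(r : nat)%:R - s%:R| + 1)^-1 : R)).
have := @harmonic_distance_sum n r (ltn_ord r) => /(ler_wpM2l _) /=.
move=> /(_ (8 * N%:R)); rewrite mulr_ge0 // => /(_ isT) h'.
by apply: (le_trans h'); rewrite le_eqVlt; apply/orP; left; apply/eqP; ring.
Qed.

End large_sieve.

(** * Dyadic cells of the circle *)

Section cells.
Context {R : realType}.
Implicit Types z w : circle R.

Lemma circle_val1 z : normc (circle_val z) = 1.
Proof.
have := set_valP z; rewrite /unit_circle /= norm_normcE.
by move=> /(congr1 (@complex.Re R)).
Qed.

Lemma circle_val_continuous : continuous (@circle_val R : circle R -> R[i]^o).
Proof. exact: initial_continuous. Qed.

Definition circle_re z : R := complex.Re (circle_val z).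
Definition circle_im z : R := complex.Im (circle_val z).

Lemma circle_sqr z : circle_re z ^+ 2 + circle_im z ^+ 2 = 1.
Proof. by rewrite -normc_sqrE circle_val1 expr1n. Qed.

Lemma normr_Re_le (x : R[i]) : `|complex.Re x| <= normc x.
Proof. by rewrite -lecR; exact: normc_ge_Re. Qed.

Lemma normr_Im_le (x : R[i]) : `|complex.Im x| <= normc x.
Proof.
rewrite -[leRHS]ger0_norm ?normc_ge0 // -ler_sqr ?nnegrE //.
by rewrite !real_normK ?num_real // normc_sqrE lerDr sqr_ge0.
Qed.

Lemma circle_continuous_R (f : R[i] -> R) :
  (forall x y, `|f x - f y| <= normc (x - y)) ->
  continuous (fun z : circle R => f (circle_val z)).
Proof.
move=> hf.
have cf : continuous (f : R[i]^o -> R).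
  move=> z; have FF : Filter (nbhs (z : R[i]^o)) by exact: (@nbhs_filter R[i]^o z).
  apply/(@cvgrPdist_le _ _ _ _ FF) => e e0.
  exists e%:C => /=; first by rewrite ltcR.
  by move=> w /=; rewrite norm_normcE ltcR => /ltW; apply: le_trans.
apply/continuousP => A oA.
have /continuousP hc := circle_val_continuous; move/continuousP: cf => cf.
exact: (hc _ (cf _ oA)).
Qed.

Lemma circle_measurable_R (f : circle R -> R) : continuous f ->
  measurable_fun setT (f : borel_circle R -> R).
Proof.
move=> /continuousP cf; apply: (measurability _ (RGenOpens.measurableE R)).
move=> _ [_ [a [b ->] <-]]; rewrite setTI; apply: sub_sigma_algebra.
exact/cf/interval_open.
Qed.

Lemma measurable_circle_re : measurable_fun setT (circle_re : borel_circle R -> R).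
Proof.
apply: circle_measurable_R; apply: circle_continuous_R => x y.
by apply: le_trans (normr_Re_le _); case: x y => [a b] [c d].
Qed.

Lemma measurable_circle_im : measurable_fun setT (circle_im : borel_circle R -> R).
Proof.
apply: circle_measurable_R; apply: circle_continuous_R => x y.
by apply: le_trans (normr_Im_le _); case: x y => [a b] [c d].
Qed.

(** Four arcs on which the circle is a graph of slope at most 1: over the real axis
    when the imaginary part dominates, over the imaginary axis otherwise. The
    second component is the sign of the dominant part. *)
Definition chart z : bool * bool :=
  if `|circle_re z| <= `|circle_im z| then (true, 0 <= circle_im z)
  else (false, 0 <= circle_re z).

Definition coord z : R :=
  if `|circle_re z| <= `|circle_im z| then circle_re z else circle_im z.

Lemma coord_bound z : -1 <= coord z <= 1.
Proof.
rewrite -ler_norml -(@expr_le1 _ 2) // real_normK ?num_real //.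
have := circle_sqr z; rewrite /coord; case: ifP => _ h.
  have := sqr_ge0 (circle_im z); lra.
have := sqr_ge0 (circle_re z); lra.
Qed.

Lemma coord_lipschitz z w : chart z = chart w ->
  `|coord z - coord w| <= normc (circle_val z - circle_val w).
Proof.
have hr := normr_Re_le (circle_val z - circle_val w).
have hi := normr_Im_le (circle_val z - circle_val w).
have er : complex.Re (circle_val z - circle_val w) = circle_re z - circle_re w.
  by rewrite /circle_re; case: (circle_val z) (circle_val w) => [? ?] [? ?].
have ei : complex.Im (circle_val z - circle_val w) = circle_im z - circle_im w.
  by rewrite /circle_im; case: (circle_val z) (circle_val w) => [? ?] [? ?].
rewrite er in hr; rewrite ei in hi.
by rewrite /chart /coord; case: ifP => _; case: ifP => _ //; case.
Qed.

(** On a chart the dominant coordinate is a 1-Lipschitz function of the other one,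
    because [b ^+ 2 - d ^+ 2 = c ^+ 2 - a ^+ 2] on the circle. *)
Lemma circle_graph_lipschitz (a b c d : R) : a ^+ 2 + b ^+ 2 = 1 ->
  c ^+ 2 + d ^+ 2 = 1 -> `|a| <= `|b| -> `|c| <= `|d| -> 0 <= b * d ->
  (b - d) ^+ 2 <= (a - c) ^+ 2.
Proof.
move=> ab1 cd1 ab cd bd.
have ab2 : a ^+ 2 <= b ^+ 2.
  by rewrite -[leLHS]real_normK ?num_real // -[leRHS]real_normK ?num_real // lerXn2r.
have cd2 : c ^+ 2 <= d ^+ 2.
  by rewrite -[leLHS]real_normK ?num_real // -[leRHS]real_normK ?num_real // lerXn2r.
have acbd : a * c <= b * d.
  apply: le_trans (ler_norm _) _; rewrite -(ger0_norm bd) !normrM.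
  exact: ler_pM.
have s0 : 0 < (b + d) ^+ 2 by nra.
rewrite -(ler_pM2r s0).
have -> : (b - d) ^+ 2 * (b + d) ^+ 2 = (a - c) ^+ 2 * (a + c) ^+ 2.
  rewrite -!exprMn -!subr_sqr.
  have -> : b ^+ 2 - d ^+ 2 = - (a ^+ 2 - c ^+ 2) by lra.
  by rewrite sqrrN.
by apply: ler_wpM2l; [exact: sqr_ge0 | nra].
Qed.

Lemma circle_dist_le_coord z w : chart z = chart w ->
  normc (circle_val z - circle_val w) <= 2 * `|coord z - coord w|.
Proof.
move=> zw.
suff h : normc (circle_val z - circle_val w) ^+ 2 <=
    2 * (coord z - coord w) ^+ 2.
  rewrite -[leLHS]ger0_norm ?normc_ge0 // -[leRHS]ger0_norm //.
  rewrite -ler_sqr ?nnegrE // !real_normK ?num_real // exprMn.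
  apply: (le_trans h); rewrite real_normK ?num_real //.
  by rewrite ler_wpM2r ?sqr_ge0 //; lra.
have -> : normc (circle_val z - circle_val w) ^+ 2 =
    (circle_re z - circle_re w) ^+ 2 + (circle_im z - circle_im w) ^+ 2.
  rewrite normc_sqrE /circle_re /circle_im.
  by case: (circle_val z) (circle_val w) => [? ?] [? ?].
have := circle_sqr z; have := circle_sqr w; move: zw; rewrite /chart /coord.
case: ifP => zz; case: ifP => ww // -[] e hw hz.
  have := @circle_graph_lipschitz _ _ _ _ hz hw zz ww.
  suff bd : 0 <= circle_im z * circle_im w by move=> /(_ bd); lra.
  move: e; case: (leP 0 (circle_im z)) => ?; case: (leP 0 (circle_im w)) => ? //= _;
  nra.
rewrite addrC in hz; rewrite addrC in hw.
have /ltW zz' : `|circle_im z| < `|circle_re z| by rewrite ltNge zz.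
have /ltW ww' : `|circle_im w| < `|circle_re w| by rewrite ltNge ww.
have := @circle_graph_lipschitz _ _ _ _ hz hw zz' ww'.
suff bd : 0 <= circle_re z * circle_re w by move=> /(_ bd); lra.
move: e; case: (leP 0 (circle_re z)) => ?; case: (leP 0 (circle_re w)) => ? //= _;
nra.
Qed.

(** The shift by 1 makes the coordinate nonnegative, so that the integer part is
    the floor. *)
Definition grid_coord (j : nat) z : nat := Num.truncn (2 ^+ j * (coord z + 1)).

Definition cell_index j z : bool * bool * nat := (chart z, grid_coord j z).

Lemma grid_coord_itv j z :
  (grid_coord j z)%:R <= 2 ^+ j * (coord z + 1) < (grid_coord j z)%:R + 1.
Proof.
rewrite [X in _ < X]natr1; apply: truncn_itv; have /andP[h _] := coord_bound z.
by rewrite mulr_ge0 ?exprn_ge0 // -lerBlDr sub0r.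
Qed.

Lemma grid_coord_bound j z : (grid_coord j z < (2 ^ j.+1).+1)%N.
Proof.
rewrite ltnS -(ler_nat R); have /andP[h _] := grid_coord_itv j z.
apply: (le_trans h); have /andP[_ h1] := coord_bound z.
rewrite expnS natrM natrX mulrC ler_wpM2r ?exprn_ge0 //; lra.
Qed.

Lemma cell_dist_le j z w : cell_index j z = cell_index j w ->
  normc (circle_val z - circle_val w) <= 2 * 2 ^- j.
Proof.
move=> /pair_equal_spec[e el]; apply: le_trans (circle_dist_le_coord _ _ e) _.
rewrite ler_pM2l // -[leRHS]mul1r ler_pdivlMr ?exprn_gt0 //.
have := grid_coord_itv j z; have := grid_coord_itv j w; rewrite el.
move=> /andP[h1 h2] /andP[h3 h4].
have p0 : 0 < 2 ^+ j :> R by rewrite exprn_gt0.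
rewrite -[X in _ * X](gtr0_norm p0) -normrM ler_norml; apply/andP; split; nra.
Qed.

(** The separation hypothesis of [large_sieve]. The loss of 1 accounts for points
    on either side of a common boundary of two cells. *)
Lemma cell_separated j z w : chart z = chart w ->
  `|(grid_coord j z)%:R - (grid_coord j w)%:R| - 1 <=
  2 ^+ j * normc (circle_val z - circle_val w).
Proof.
move=> e; have p0 : 0 < 2 ^+ j :> R by rewrite exprn_gt0.
apply: (@le_trans _ _ (2 ^+ j * `|coord z - coord w|)); last first.
  by rewrite ler_pM2l //; exact: coord_lipschitz.
rewrite -{1}(gtr0_norm p0) -normrM lerBlDr.
have -> : 2 ^+ j * (coord z - coord w) =
  2 ^+ j * (coord z + 1) - 2 ^+ j * (coord w + 1) by ring.
have := grid_coord_itv j z; have := grid_coord_itv j w.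
set X : R := 2 ^+ j * (coord z + 1).
set Y : R := 2 ^+ j * (coord w + 1) => /andP[h1 h2] /andP[h3 h4].
have h5 := ler_norm (X - Y); have h6 := ler_norm (- (X - Y)).
rewrite normrN in h6; rewrite ler_norml; apply/andP; split; lra.
Qed.

Lemma measurable_coord : measurable_fun setT (coord : borel_circle R -> R).
Proof.
apply: measurable_fun_ifT; [|exact: measurable_circle_re|
  exact: measurable_circle_im].
apply: measurable_fun_ler; apply: measurableT_comp => //.
  exact: measurable_circle_re.
exact: measurable_circle_im.
Qed.

Definition cell j (q : bool * bool * nat) : set (circle R) :=
  [set z | cell_index j z = q].

Lemma measurable_cell j q : measurable (cell j q : set (borel_circle R)).
Proof.
pose f (z : borel_circle R) := cell_index j z == q.
suff mf : measurable_fun setT f.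
  have -> : cell j q = setT `&` f @^-1` [set true].
    by rewrite setTI; apply/seteqP; split => z /= /eqP.
  exact: mf.
case: q @f => -[b1 b2] i f.
pose re : borel_circle R -> R := circle_re; pose im : borel_circle R -> R := circle_im.
pose co : borel_circle R -> R := coord.
have mre : measurable_fun setT re by exact: measurable_circle_re.
have mim : measurable_fun setT im by exact: measurable_circle_im.
have mco : measurable_fun setT co by exact: measurable_coord.
have -> : f = (fun z : borel_circle R =>
    (if `|re z| <= `|im z| then b1 && ((0 <= im z) == b2)
     else ~~ b1 && ((0 <= re z) == b2)) &&
    ((i%:R <= 2 ^+ j * (co z + 1)) &&
     (2 ^+ j * (co z + 1) < i.+1%:R))).
  apply/funext => z; rewrite /f /cell_index xpair_eqE; congr (_ && _).
    rewrite /chart /re /im; case: ifP => _; rewrite xpair_eqE.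
      by rewrite eq_sym; case: (b1).
    by rewrite eq_sym; case: (b1).
  have /andP[h _] := coord_bound z.
  have h0 : 0 <= 2 ^+ j * (coord z + 1).
    by rewrite mulr_ge0 ?exprn_ge0 // -lerBlDr sub0r.
  apply/eqP/idP => [<-|hh].
    by have := grid_coord_itv j z; rewrite [X in _ < X]natr1.
  exact: truncn_def.
have mle (g h : borel_circle R -> R) : measurable_fun setT g ->
   measurable_fun setT h -> measurable_fun setT (fun z : borel_circle R => g z <= h z).
  exact: measurable_fun_ler.
have meq (g : borel_circle R -> R) : measurable_fun setT g ->
    measurable_fun setT (fun z : borel_circle R => (0 <= g z) == b2).
  move=> mg; case: (b2).
    by under eq_fun do rewrite eqb_id; apply: mle.
  by under eq_fun do rewrite eqbF_neg; apply: measurable_neg; apply: mle.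
have m2 : measurable_fun setT (fun z : borel_circle R => 2 ^+ j * (co z + 1)).
  by apply: measurable_funM => //; apply: measurable_funD.
apply: measurable_and; last first.
  by apply: measurable_and; [exact: mle | exact: measurable_fun_ltr].
apply: measurable_fun_ifT; last first.
- by apply: measurable_and => //; exact: meq.
- by apply: measurable_and => //; exact: meq.
by apply: mle; apply: measurableT_comp.
Qed.


Lemma cell_diam_le j q : 0 <= diam (cell j q) <= 2 * 2 ^- j.
Proof.
have p0 : 0 <= 2 * 2 ^- j :> R by rewrite mulr_ge0 // invr_ge0 exprn_ge0.
rewrite /diam; set D := [set _ | _ in _ & _ in _].
have ubD : ubound D (2 * 2 ^- j).
  move=> t [z qz [w qw] et]; rewrite -et; apply: cell_dist_le.
  by move: qz qw; rewrite /cell /= => -> ->.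
have [[z qz]|ne] := pselect (cell j q !=set0); last first.
  suff -> : D = set0 by rewrite sup0 lexx.
  by apply/seteqP; split => // t [z qz _]; apply: ne; exists z.
have D0 : D 0 by exists z => //; exists z => //; rewrite subrr normc0.
apply/andP; split; last by apply: ge_sup => //; exists 0.
by apply: ub_le_sup => //; exists (2 * 2 ^- j).
Qed.

Lemma trivIset_cell j D : trivIset D (cell j).
Proof. by move=> q q' _ _ [z []]; rewrite /cell /= => -> ->. Qed.

End cells.

(** * From alpha-continuity to uniformly light cells *)

Section heavy_cells.
Context {R : realType}.
Variable mu : {finite_measure set (borel_circle R) -> \bar R}.

Definition total_mass : R := fine (mu setT).

Lemma total_massE : mu setT = total_mass%:E.
Proof. by rewrite /total_mass fineK // fin_num_measure. Qed.

Lemma total_mass_ge0 : 0 <= total_mass.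
Proof. by rewrite fine_ge0. Qed.

Lemma measure_le_total (A : set (borel_circle R)) : measurable A ->
  (mu A <= total_mass%:E)%E.
Proof. by move=> mA; rewrite -total_massE le_measure ?inE. Qed.

(** The cells of one scale are disjoint, so their masses sum to at most the total
    mass, whatever the set [D] of cells. *)
Lemma esum_cell_le j D (c : R) : 0 <= c ->
  (\esum_(q in D) (c%:E * mu (cell j q)) <= (c * total_mass)%:E)%E.
Proof.
move=> c0; apply: ge_ereal_sup => _ [X [finX _] <-].
rewrite -ge0_mule_fsumr //.
rewrite -(@measure_fin_bigcup _ _ _ mu) //; first last.
- by move=> q _; exact: measurable_cell.
- exact: trivIset_cell.
rewrite EFinM lee_wpmul2l ?lee_fin //; apply: measure_le_total.
by apply: fin_bigcup_measurable => // q _; exact: measurable_cell.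
Qed.

Lemma esum_geometric_tail_le (c rho : R) J : 0 <= c -> 0 <= rho < 1 ->
  (\esum_(j in [set j | (J <= j)%N]) (c * rho ^+ j)%:E <=
   (c * (rho ^+ J / (1 - rho)))%:E)%E.
Proof.
move=> c0 /andP[r0 r1].
have t0 j : (0 <= (c * rho ^+ j)%:E)%E by rewrite lee_fin mulr_ge0 ?exprn_ge0.
have := @nneseries_esum R (fun j => (c * rho ^+ j)%:E) (fun j => (J <= j)%N).
move=> <- //; apply: lime_le.
  exact: is_cvg_nneseries_cond.
apply: nearW => n; rewrite sumEFin lee_fin -mulr_sumr ler_wpM2l //.
rewrite ler_pdivlMr ?subr_gt0 //.
suff -> : (\sum_(0 <= i < n | (J <= i)%N) rho ^+ i) * (1 - rho) =
    rho ^+ J - rho ^+ maxn J n by rewrite lerBlDr lerDl exprn_ge0.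
elim: n => [|n IH]; first by rewrite big_geq // maxn0 subrr mul0r.
rewrite big_mkcond big_nat_recr //= -big_mkcond /= mulrDl IH.
case: (leqP J n) => Jn.
  by rewrite (maxn_idPr (leqW Jn)) exprS; ring.
by rewrite (maxn_idPl Jn) mul0r addr0.
Qed.

Definition heavy_points (theta : R) (j : nat) : set (circle R) :=
  [set z | ((theta ^+ j)%:E < mu (cell j (cell_index j z)))%E].

Definition heavy_limsup (theta : R) : set (circle R) :=
  \bigcap_J \bigcup_(j in [set j | (J <= j)%N]) heavy_points theta j.

Lemma hausdorff_pre_ge0 a (E : set (circle R)) delta :
  (0 <= hausdorff_pre a E delta)%E.
Proof.
apply: le_ereal_inf_tmp => _ [J [S [_ _ ->]]]; apply: esum_ge0 => n _.
by rewrite lee_fin powR_ge0.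
Qed.

(** A cell of scale [j] that is heavy has diameter at most [2 * 2 ^- j] and mass at
    least [theta ^+ j]; hence its diameter to the power [a] is at most its mass
    times [2 `^ a * rho ^+ j], where [rho = 2 `^ (- a) / theta < 1]. Summing over the
    disjoint cells of a scale, and then over all scales beyond [J], leaves the
    tail of a geometric series. The gap between [2 `^ (- a)] and [theta] pays for the
    redundancy of the cover, which uses all these scales at once. *)
Lemma hausdorff_pre_heavy_limsup (a theta delta : R) : 0 <= a -> 0 < theta ->
  2 `^ (- a) < theta -> 0 < delta ->
  hausdorff_pre a (heavy_limsup theta) delta = 0%E.
Proof.
move=> a0 th0 ath d0; set kappa : R := 2 `^ (- a).
have k0 : 0 < kappa by exact: powR_gt0.
pose rho := kappa / theta.
have r01 : 0 <= rho < 1.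
  by rewrite divr_ge0 ?ltW //= ltr_pdivrMr // mul1r.
pose c := 2 `^ a * total_mass.
have c0 : 0 <= c by rewrite mulr_ge0 ?powR_ge0 ?total_mass_ge0.
apply/eqP; rewrite eq_le hausdorff_pre_ge0 andbT.
apply/lee_addgt0Pr => e e0; rewrite add0e.
(* a scale that makes both the diameters and the tail of the series small *)
have [J [J1 J2]] : exists J, 2 * 2 ^- J < delta /\
    c * (rho ^+ J / (1 - rho)) <= e.
  have h1 : \forall J \near \oo, 2 * 2 ^- J < delta.
    have : (fun J => 2 * 2^-1 ^+ J) @ \oo --> (2 * 0 : R).
      by apply: cvgMr; apply: cvg_expr; rewrite ger0_norm; lra.
    rewrite mulr0 => /cvgr_lt /(_ _ d0); apply: filterS => J.
    by rewrite exprVn.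
  have h2 : \forall J \near \oo, c * (rho ^+ J / (1 - rho)) < e.
    have : (fun J => c * (rho ^+ J / (1 - rho))) @ \oo --> (c * (0 / (1 - rho)) : R).
      apply: cvgMr; apply: cvgMl; apply: cvg_expr.
      by case/andP: r01 => r0 r1; rewrite ger0_norm.
    by rewrite mul0r mulr0 => /cvgr_lt /(_ _ e0).
  have [J _ /(_ J (leqnn J)) [? /ltW ?]] : \forall J \near \oo,
      2 * 2 ^- J < delta /\ c * (rho ^+ J / (1 - rho)) < e by exact: filterI.
  by exists J.
(* the cover: heavy cells of scale at least [J], encoded as natural numbers *)
pose I := [set j | (J <= j)%N] `*`` (fun j =>
  [set q : bool * bool * nat | ((theta ^+ j)%:E < mu (cell j q))%E]).
pose S (n : nat) : set (circle R) :=
  if @unpickle (nat * (bool * bool * nat))%type n is Some k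
  then cell k.1 k.2 else set0.
have SE k : S (pickle k) = cell k.1 k.2 by rewrite /S pickleK.
apply: (@le_trans _ _ (\esum_(n in pickle @` I) (diam (S n) `^ a)%:E)%E).
  apply: ereal_inf_lbound; exists (pickle @` I), S; split => //.
    move=> _ [k [/= Jk _] <-]; rewrite SE.
    have /andP[_ h] := @cell_diam_le R k.1 k.2; apply: le_lt_trans J1.
    apply: (le_trans h); rewrite ler_pM2l // lef_pV2 ?posrE ?exprn_gt0 //.
    by rewrite ler_eXn2l //; lra.
  move=> z /(_ J Logic.I) [j Jj zj]; exists (pickle (j, cell_index j z)).
    by exists (j, cell_index j z).
  by rewrite SE.
rewrite esum_image; last by move=> ? ? _ _; exact: (pcan_inj pickleK).
have -> : (\esum_(i in I) (diam (S (pickle i)) `^ a)%:E = \esum_(i in I)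
    (diam (cell i.1 i.2) `^ a)%:E)%E by apply: eq_esum => k _; rewrite SE.
rewrite -(esum_esum (a := fun j q => (diam (cell j q) `^ a)%:E)); last first.
  by move=> j q _ _; rewrite lee_fin powR_ge0.
apply: (@le_trans _ _ (\esum_(j in [set j | (J <= j)%N])
   (c * rho ^+ j)%:E)%E); last first.
  by apply: (le_trans (esum_geometric_tail_le _ _ _ c0 r01)); rewrite lee_fin.
apply: le_esum => j _.
have -> : c * rho ^+ j = 2 `^ a * rho ^+ j * total_mass by rewrite /c; ring.
have cj0 : 0 <= 2 `^ a * rho ^+ j.
  by rewrite mulr_ge0 ?powR_ge0 // exprn_ge0 //; case/andP: r01.
apply: le_trans (esum_cell_le j _ _ cj0); apply: le_esum => q /= hq.
have -> : 2 `^ a * rho ^+ j = (2 * 2 ^- j) `^ a / theta ^+ j.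
  have E1 : (2 ^+ j)^-1 = 2 `^ (- j%:R) :> R by rewrite powRN powR_mulrn.
  have E2 : (2 `^ (- j%:R)) `^ a = kappa ^+ j :> R.
    have -> : kappa ^+ j = kappa `^ j%:R by rewrite powR_mulrn // ltW.
    by rewrite /kappa -(powRrM 2 (- a)) -(powRrM 2 (- j%:R)); congr (_ `^ _); ring.
  by rewrite powRM ?invr_ge0 ?exprn_ge0 // E1 E2 /rho expr_div_n mulrA.
have /andP[d1 d2] := @cell_diam_le R j q.
apply: (@le_trans _ _ ((2 * 2 ^- j) `^ a)%:E).
  by rewrite lee_fin ge0_ler_powR // nnegrE // (le_trans d1).
apply: (@le_trans _ _ (((2 * 2 ^- j) `^ a / theta ^+ j)%:E * (theta ^+ j)%:E)%E).
  by rewrite -EFinM lee_fin divfK // gt_eqF // exprn_gt0.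
by rewrite lee_wpmul2l ?ltW // lte_fin divr_gt0 ?exprn_gt0 // powR_gt0.
Qed.

Lemma hausdorff_heavy_limsup (a theta : R) : 0 <= a -> 0 < theta ->
  2 `^ (- a) < theta -> hausdorff_measure a (heavy_limsup theta) = 0%E.
Proof.
move=> a0 th0 ath; rewrite /hausdorff_measure.
apply: cvg_lim => //; apply: cvg_near_cst.
by near=> d; apply: hausdorff_pre_heavy_limsup.
Unshelve. all: by end_near. Qed.

Lemma measurable_heavy_points (theta : R) j :
  measurable (heavy_points theta j : set (borel_circle R)).
Proof.
pose D := [set q : bool * bool * nat | ((theta ^+ j)%:E < mu (cell j q))%E /\
   (q.2 < (2 ^ j.+1).+1)%N].
have -> : heavy_points theta j = \bigcup_(q in D) cell j q.
  apply/seteqP; split => [z zb|z [q [qb _] zq]].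
    by exists (cell_index j z) => //; split => //; exact: grid_coord_bound.
  by rewrite /heavy_points /=; move: zq; rewrite /cell /= => ->.
apply: fin_bigcup_measurable => [|q _]; last exact: measurable_cell.
apply: (@sub_finite_set _ _ ([set: bool * bool] `*` `I_((2 ^ j.+1).+1))).
  by move=> q [].
by apply: finite_setX => //; exact: finite_II.
Qed.

(** Off a set of small mass, an [a]-continuous measure obeys a uniform power bound,
    of any exponent smaller than [a], on all sufficiently fine cells: the points
    in infinitely many heavy cells form a null set, which is the decreasing
    limit of the points that lie in some heavy cell of scale at least [J]. *)
Lemma large_regular_set (a theta e : R) : alpha_continuous a mu ->
  0 <= a -> 0 < theta -> 2 `^ (- a) < theta -> 0 < e ->
  exists (S : set (borel_circle R)) (J : nat), [/\ measurable S,
    (mu (~` S) < e%:E)%E &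
    forall z j, S z -> (J <= j)%N ->
      (mu (cell j (cell_index j z)) <= (theta ^+ j)%:E)%E].
Proof.
move=> ac a0 th0 ath e0.
pose B J : set (borel_circle R) :=
  \bigcup_(j in [set j | (J <= j)%N]) heavy_points theta j.
have mB J : measurable (B J).
  by apply: bigcup_measurable => j _; exact: measurable_heavy_points.
have mBl : measurable (\bigcap_J B J) by exact: bigcap_measurable.
have muB : mu (\bigcap_J B J) = 0%E.
  by apply/negligibleP => //; apply: ac; exact: hausdorff_heavy_limsup.
have : mu \o B @ \oo --> mu (\bigcap_J B J).
  apply: nonincreasing_cvg_mu => //.
    by rewrite ltey_eq fin_num_measure.
  move=> m n mn; apply/subsetPset => z [j /= nj zj].
  by exists j => //=; exact: leq_trans nj.
rewrite muB => /(_ [set u | (u < e%:E)%E]) [|J _ /(_ J (leqnn J)) hJ].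
  by apply: open_ereal_lt'; rewrite lte_fin.
exists (~` B J), J; split; first exact: measurableC.
  by rewrite setCK.
move=> z j zS Jj; rewrite leNgt; apply/negP => h; apply: zS.
by exists j.
Qed.

End heavy_cells.

(** * The Borel functional calculus *)

Section bounded_borel_closure.
Context {R : realType}.
Implicit Types f g : borel_circle R -> R[i].

Lemma bounded_borel_cst c : bounded_borel (fun=> c : R[i]).
Proof.
by split; [exact: measurable_cst | exact: measurable_cst | exists (normc c)].
Qed.

Lemma bounded_borelM f g : bounded_borel f -> bounded_borel g ->
  bounded_borel (fun z => f z * g z).
Proof.
move=> [rf mf [M hM]] [rg mg [N hN]]; split.
- have -> : (fun z => complex.Re (f z * g z)) = (fun z =>
      complex.Re (f z) * complex.Re (g z) - complex.Im (f z) * complex.Im (g z)).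
    by apply/funext => z; case: (f z) (g z) => [? ?] [? ?].
  by apply: measurable_funB; apply: measurable_funM.
- have -> : (fun z => complex.Im (f z * g z)) = (fun z =>
      complex.Re (f z) * complex.Im (g z) + complex.Im (f z) * complex.Re (g z)).
    by apply/funext => z; case: (f z) (g z) => [? ?] [? ?].
  by apply: measurable_funD; apply: measurable_funM.
- exists (M * N) => z; rewrite normrM rmorphM.
  by apply: ler_pM; rewrite ?normr_ge0.
Qed.

Lemma bounded_borelD f g : bounded_borel f -> bounded_borel g ->
  bounded_borel (fun z => f z + g z).
Proof.
move=> [rf mf [M hM]] [rg mg [N hN]]; split.
- have -> : (fun z => complex.Re (f z + g z)) = (fun z =>
      complex.Re (f z) + complex.Re (g z)).
    by apply/funext => z; case: (f z) (g z) => [? ?] [? ?].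
  exact: measurable_funD.
- have -> : (fun z => complex.Im (f z + g z)) = (fun z =>
      complex.Im (f z) + complex.Im (g z)).
    by apply/funext => z; case: (f z) (g z) => [? ?] [? ?].
  exact: measurable_funD.
- exists (M + N) => z; rewrite rmorphD.
  by apply: le_trans (ler_normD _ _) _; apply: lerD.
Qed.

Lemma bounded_borelJ f : bounded_borel f -> bounded_borel (fun z => conjc (f z)).
Proof.
move=> [rf mf [M hM]]; split.
- have -> : (fun z => complex.Re (conjc (f z))) = (fun z => complex.Re (f z)).
    by apply/funext => z; case: (f z).
  exact: rf.
- have -> : (fun z => complex.Im (conjc (f z))) = (fun z => - complex.Im (f z)).
    by apply/funext => z; case: (f z).
  exact: measurable_funN.
- by exists M => z; rewrite norm_normcE normc_conj -norm_normcE.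
Qed.

Lemma bounded_borel_val : bounded_borel (@circle_val R).
Proof.
split; [exact: measurable_circle_re | exact: measurable_circle_im |].
by exists 1 => z; rewrite norm_normcE circle_val1.
Qed.

Lemma bounded_borel_exp k : bounded_borel (fun z => @circle_val R z ^+ k).
Proof.
elim: k => [|k IH].
  by under eq_fun do rewrite expr0; exact: bounded_borel_cst.
by under eq_fun do rewrite exprS; apply: bounded_borelM => //; exact: bounded_borel_val.
Qed.

Lemma bounded_borel_sum K (c : 'I_K -> R[i]) (g : 'I_K -> borel_circle R -> R[i]) :
  (forall k, bounded_borel (g k)) -> bounded_borel (fun z => \sum_k c k * g k z).
Proof.
elim: K c g => [|K IH] c g hg.
  by under eq_fun do rewrite big_ord0; exact: bounded_borel_cst.
under eq_fun do rewrite big_ord_recl.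
apply: bounded_borelD; last exact: IH.
by apply: bounded_borelM => //; exact: bounded_borel_cst.
Qed.

Definition cindic (S : set (borel_circle R)) : borel_circle R -> R[i] :=
  fun z => (\1_S z)%:C.

Lemma bounded_borel_cindic S : measurable S -> bounded_borel (cindic S).
Proof.
move=> mS; split; [exact: measurable_indic | exact: measurable_cst |].
by exists 1 => z; rewrite /cindic indicE norm_normcE; case: (_ \in _);
  rewrite ?normc1 ?normc0 lecR.
Qed.

End bounded_borel_closure.

Section calculus.
Context {R : realType} {H : hilbertType R}.
Variables (U : H -> H) (F : (borel_circle R -> R[i]) -> H -> H).
Hypothesis calc : borel_calculus U F.
Implicit Types f g : borel_circle R -> R[i].

Lemma calculus0 x : F (fun=> 0) x = 0.
Proof.
have := calculus_linear calc (-1)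
  (bounded_borel_cst 1) (bounded_borel_cst 1) x.
rewrite (calculus_one calc) scaleN1r addNr => <-.
by congr (F _ x); apply/funext => z; rewrite mulr1 addNr.
Qed.

Lemma calculus_sum K (c : 'I_K -> R[i]) (g : 'I_K -> borel_circle R -> R[i]) x :
  (forall k, bounded_borel (g k)) ->
  F (fun z => \sum_k c k * g k z) x = \sum_k c k *: F (g k) x.
Proof.
elim: K c g => [|K IH] c g hg.
  by rewrite big_ord0 -[RHS](calculus0 x); congr (F _ x); apply/funext => z;
    rewrite big_ord0.
rewrite big_ord_recl -IH // -(calculus_linear calc) //; last exact: bounded_borel_sum.
by congr (F _ x); apply/funext => z; rewrite big_ord_recl.
Qed.

(** On the spectral side the dynamics is multiplication by [z ^+ k]. *)
Lemma calculus_exp k x : F (fun z => circle_val z ^+ k) x = iter k U x.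
Proof.
elim: k => [|k IH] /=.
  by rewrite -[RHS](calculus_one calc); congr (F _ x); apply/funext => z; rewrite expr0.
rewrite -IH -(calculus_id calc) -(calculus_mul calc); last exact: bounded_borel_exp.
  by congr (F _ x); apply/funext => z; rewrite exprS.
exact: bounded_borel_val.
Qed.

Lemma inner_calculus_sqr f x : bounded_borel f ->
  inner (F f x) (F f x) = inner x (F (fun z => (normc (f z) ^+ 2)%:C) x).
Proof.
move=> bf; rewrite (calculus_conj calc) // -(calculus_mul calc) //.
  by congr (inner x (F _ x)); apply/funext => z; rewrite -conj_mulE.
exact: bounded_borelJ.
Qed.

Variables (mu : {finite_measure set (borel_circle R) -> \bar R}) (y : H).
Hypothesis spec : forall f, bounded_borel f -> inner y (F f y) = cintegral mu f.

Lemma bounded_borel_normc2 f : bounded_borel f ->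
  bounded_borel (fun z => (normc (f z) ^+ 2)%:C).
Proof.
move=> bf; have -> : (fun z => (normc (f z) ^+ 2)%:C) =
    (fun z => conjc (f z) * f z) by apply/funext => z; rewrite conj_mulE.
by apply: bounded_borelM => //; exact: bounded_borelJ.
Qed.

(** The spectral measure turns norms of vectors [F f y] into integrals of
    [`|f| ^+ 2]: this is where Hilbert space estimates become estimates for
    functions on the circle. *)
Lemma sqnorm_calculus f : bounded_borel f ->
  sqnorm (F f y) = fine (\int[mu]_z (normc (f z) ^+ 2)%:E)%E.
Proof.
move=> bf; rewrite /sqnorm inner_calculus_sqr // spec //.
exact: bounded_borel_normc2.
Qed.

End calculus.

(** * Trigonometric polynomials against a measure with light cells *)

(** A substitute for a maximum point, for functions on sets where the supremum need
    not be attained. *)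
Lemma exists_half_max {R : realType} (T : Type) (A : set T) (g : T -> R) (M : R) :
  A !=set0 -> (forall x, 0 <= g x <= M) ->
  exists x, A x /\ forall w, A w -> g w <= 2 * g x.
Proof.
move=> [a Aa] gM; have hs : has_sup (g @` A).
  split; first by exists (g a), a.
  by exists M => _ [x _ <-]; case/andP: (gM x).
have ub w : A w -> g w <= sup (g @` A).
  by move=> Aw; apply: sup_upper_bound => //; exists w.
have [s0|s0] := leP (sup (g @` A)) 0.
  exists a; split => // w Aw; apply: (le_trans (ub _ Aw)).
  by apply: (le_trans s0); case/andP: (gM a) => h _; rewrite mulr_ge0.
have s2 : 0 < sup (g @` A) / 2 by rewrite divr_gt0.
have [_ [x Ax <-] hx] := sup_adherent s2 hs.
exists x; split => // w Aw; apply: (le_trans (ub _ Aw)); lra.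
Qed.

Section sieve_integral.
Context {R : realType}.
Variable mu : {finite_measure set (borel_circle R) -> \bar R}.

(** On each cell, replace [`|p| ^+ 2] by twice its value at a well-chosen point of
    [S]. The mass of the cell is at most [t], and within one chart the chosen
    points are separated at scale [2 ^- j], so the large sieve bounds the sum of
    the values. The constant is 2 (choice of points) times 4 (charts) times 16
    (large sieve); the harmonic sum contributes [j%:R + 3]. *)
Lemma sieve_integral (S : set (borel_circle R)) (j K : nat) (t : R)
    (c : 'I_K -> R[i]) : measurable S -> 0 <= t ->
  (forall z, S z -> (mu (cell j (cell_index j z)) <= t%:E)%E) ->
  (K <= 2 * 2 ^ j)%N ->
  (\int[mu]_z (normc ((\sum_k c k * circle_val z ^+ k) * cindic S z) ^+ 2)%:E <=
   (128 * 2 ^+ j * (j%:R + 3) * t * \sum_k normc (c k) ^+ 2)%:E)%E.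
Proof.
move=> mS t0 hS KN.
pose p (z : borel_circle R) := \sum_k c k * circle_val z ^+ k.
pose n := (2 ^ j.+1).+1.
pose Q : finType := (bool * bool * 'I_n)%type.
pose code (q : Q) : bool * bool * nat := (q.1, q.2 : nat).
pose A (q : Q) : set (borel_circle R) := cell j (code q) `&` S.
pose g z := normc (p z) ^+ 2.
have g0 z : 0 <= g z by exact: sqr_ge0.
have [M gM] : exists M, forall z, g z <= M.
  exists ((\sum_k normc (c k)) ^+ 2) => z.
  rewrite lerXn2r ?nnegrE ?normc_ge0 ?sumr_ge0 // => [k _|].
    exact: normc_ge0.
  apply: le_trans (normc_sum _ _ _ _) _; apply: ler_sum => k _.
  by rewrite normcM normcX circle_val1 expr1n mulr1.
have /choice [x hx] : forall q : Q, exists x : borel_circle R,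
    A q !=set0 -> A q x /\ forall w, A q w -> g w <= 2 * g x.
  move=> q; have [ne|] := pselect (A q !=set0); last by exists point.
  have [//|x0 hx0] := exists_half_max _ (A q) g M ne; first by move=> z; rewrite g0 gM.
  by exists x0.
pose P (q : Q) : bool := `[< A q !=set0 >].
pose m (q : Q) : R := if P q then 2 * g (x q) else 0.
have m0 q : 0 <= m q by rewrite /m; case: ifP => // _; rewrite mulr_ge0.
have mA q : ((m q)%:E * mu (cell j (code q)) <= (t * m q)%:E)%E.
  rewrite /m; case: ifPn => [/asboolP Pq|_]; last by rewrite mul0e mulr0.
  have [[/= xc xS] _] := hx _ Pq.
  rewrite [t * _]mulrC [leRHS]EFinM lee_wpmul2l ?lee_fin ?mulr_ge0 ?normc_ge0 //.
  have e : cell_index j (x q) = code q by exact: xc.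
  by have := hS _ xS; rewrite e.
have mI (q : Q) : measurable_fun setT
    (fun z : borel_circle R => (\1_(cell j (code q)) z : R)%:E).
  by apply/measurable_EFinP; apply: measurable_indic; exact: measurable_cell.
have mmI (q : Q) : measurable_fun setT
    (fun z : borel_circle R => (m q)%:E * (\1_(cell j (code q)) z : R)%:E)%E.
  exact: measurable_funeM.
have bf : bounded_borel (fun z : borel_circle R =>
    (\sum_k c k * circle_val z ^+ k) * cindic S z).
  apply: bounded_borelM; last exact: bounded_borel_cindic.
  by apply: bounded_borel_sum => k; exact: bounded_borel_exp.
apply: (@le_trans _ _ (\int[mu]_z \sum_(q : Q) (m q)%:E * (\1_(cell j (code q)) z)%:E)%E).
  apply: ge0_le_integral => //.
  - by move=> z _; rewrite lee_fin sqr_ge0.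
  - by apply/measurable_EFinP; have [] := bounded_borel_normc2 _ bf.
  - exact: emeasurable_sum.
  move=> z _; rewrite -/(p z).
  have lz := grid_coord_bound j z.
  pose q0 : Q := (chart z, Ordinal lz).
  have zq : cell j (code q0) z by [].
  apply: (@le_trans _ _ ((m q0)%:E * (\1_(cell j (code q0)) z)%:E)%E); last first.
    rewrite (bigD1 q0) //= leeDl // sume_ge0 // => q _.
    by rewrite -EFinM lee_fin mulr_ge0.
  rewrite -EFinM lee_fin indicE mem_set // mulr1.
  rewrite /cindic indicE; case: (boolP (z \in S)) => [/set_mem zS|_]; last first.
    by rewrite mulr0 normc0 expr0n.
  have Aq : A q0 z by [].
  have ne : A q0 !=set0 by exists z.
  rewrite mulr1 /m /P asboolT //.
  by have [_] := hx _ ne; apply.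
rewrite ge0_integral_sum //; last first.
  by move=> q z _; rewrite -EFinM lee_fin mulr_ge0.
apply: (@le_trans _ _ (\sum_(q : Q) (t * m q)%:E)%E).
  apply: lee_sum => q _.
  rewrite ge0_integralZl_EFin //.
  rewrite integral_indic ?setIT //; exact: measurable_cell.
rewrite sumEFin lee_fin -mulr_sumr.
suff h : \sum_q m q <= 128 * 2 ^+ j * (j%:R + 3) * \sum_k normc (c k) ^+ 2.
  by apply: le_trans (ler_wpM2l t0 h) _; rewrite le_eqVlt; apply/orP; left;
    apply/eqP; ring.
rewrite /m -big_mkcond -mulr_sumr.
have -> : \sum_(q | P q) g (x q) =
    \sum_(b : bool * bool) \sum_(l | P (b, l)) g (x (b, l)).
  by rewrite pair_big_dep /=; apply: eq_big => -[b l].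
set Sc := \sum_k normc (c k) ^+ 2.
have hc b : \sum_(l | P (b, l)) g (x (b, l)) <= 16 * 2 ^+ j * (j%:R + 3) * Sc.
  have Sc0 : 0 <= Sc by apply: sumr_ge0 => k _; exact: sqr_ge0.
  have xP l : P (b, l) -> chart (x (b, l)) = b /\ grid_coord j (x (b, l)) = l.
    by move=> /asboolP /hx [[/= []]].
  apply: le_trans (@large_sieve R n (2 ^ j) K (fun l => P (b, l))
    (fun l => circle_val (x (b, l))) c KN _ _) _.
  - by move=> l _; exact: circle_val1.
  - move=> r s /xP[r1 r2] /xP[s1 s2]; rewrite natrX -r2 -s2.
    by apply: cell_separated; rewrite r1 s1.
  rewrite natrX ler_wpM2r // ler_wpM2l ?mulr_ge0 ?exprn_ge0 //.
  apply: (@le_trans _ _ (harmonic_sum (2 ^ j.+2))).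
    apply: harmonic_sum_mono; rewrite /n [(2 ^ j.+2)%N]expnS mul2n -addnn.
    by rewrite -addn1 leq_add2l expn_gt0.
  by apply: le_trans (harmonic_sum_exp2 _) _; rewrite -addn2 natrD; lra.
apply: (@le_trans _ _ (2 * \sum_(b : bool * bool) 16 * 2 ^+ j * (j%:R + 3) * Sc)).
  by rewrite ler_wpM2l //; apply: ler_sum => b _; exact: hc.
rewrite sumr_const card_prod card_bool -mulr_natr le_eqVlt; apply/orP; left.
apply/eqP; ring.
Qed.

End sieve_integral.

Lemma fine_le_real {R : realType} (x : \bar R) (b : R) :
  0 <= b -> (x <= b%:E)%E -> fine x <= b.
Proof. by case: x => [r||] //= b0; rewrite lee_fin. Qed.

Section spectral_bounds.
Context {R : realType} {H : hilbertType R}.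
Variables (U : H -> H) (F : (borel_circle R -> R[i]) -> H -> H).
Hypothesis calc : borel_calculus U F.
Variables (mu : {finite_measure set (borel_circle R) -> \bar R}) (y : H).
Hypothesis spec : forall f, bounded_borel f -> inner y (F f y) = cintegral mu f.

Lemma sqnorm_calculus_indic_compl S : measurable S ->
  (sqnorm (y - F (cindic S) y))%:E = mu (~` S).
Proof.
move=> mS; have mSc : measurable (~` S) by exact: measurableC.
have -> : y - F (cindic S) y = F (cindic (~` S)) y.
  have b1 := @bounded_borel_cindic R S mS.
  have := calculus_linear calc (-1) b1 (bounded_borel_cst 1) y.
  rewrite (calculus_one calc) scaleN1r addrC => <-.
  congr (F _ y); apply/funext => z; rewrite /cindic !indicE in_setC.
  by case: (z \in S); rewrite mulN1r /= ?addNr ?oppr0 ?add0r.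
rewrite (sqnorm_calculus _ _ calc _ _ spec); last exact: bounded_borel_cindic.
have -> : (\int[mu]_z (normc (cindic (~` S) z) ^+ 2)%:E)%E =
    (\int[mu]_z (\1_(~` S) z)%:E)%E.
  apply: eq_integral => z _; rewrite /cindic indicE.
  by case: (_ \in _); rewrite ?normc1 ?normc0 ?expr1n ?expr0n.
by rewrite integral_indic // setIT fineK // fin_num_measure.
Qed.

(** A Strichartz-type estimate: the vectors [iter k U x], for [k < K], are far from
    lining up with any given vector when the spectral measure of [x] has light
    cells at scale [1 / K]. By duality it suffices to bound the norm of
    [\sum_k c k *: iter k U x], which is the integral of [sieve_integral]. *)
Lemma spectral_sieve (S : set (borel_circle R)) (j K : nat) (t : R) :
  measurable S -> 0 <= t ->
  (forall z, S z -> (mu (cell j (cell_index j z)) <= t%:E)%E) ->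
  (K <= 2 * 2 ^ j)%N ->
  forall x, \sum_(k < K) normc (inner x (iter k U (F (cindic S) y))) ^+ 2 <=
    128 * 2 ^+ j * (j%:R + 3) * t * sqnorm x.
Proof.
move=> mS t0 hS KN; apply: hilbert_duality.
  by rewrite !mulr_ge0 ?exprn_ge0 ?addr_ge0.
move=> c; have bS := @bounded_borel_cindic R S mS.
have be k := @bounded_borel_exp R k.
have bp : bounded_borel (fun z => \sum_(k < K) c k * circle_val z ^+ k).
  by apply: bounded_borel_sum => k; exact: be.
have -> : \sum_k c k *: iter k U (F (cindic S) y) =
    F (fun z => (\sum_(k < K) c k * circle_val z ^+ k) * cindic S z) y.
  rewrite (calculus_mul calc) // (calculus_sum _ _ calc) => [|k]; last exact: be.
  by apply: eq_bigr => k _; rewrite (calculus_exp _ _ calc).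
rewrite (sqnorm_calculus _ _ calc _ _ spec); last exact: bounded_borelM.
apply: fine_le_real; last exact: sieve_integral.
apply: mulr_ge0; last by apply: sumr_ge0 => k _; exact: sqr_ge0.
by rewrite !mulr_ge0 ?exprn_ge0 ?addr_ge0.
Qed.

End spectral_bounds.

(** * Orthonormal bases and finite sets of sites *)

Section orthonormal.
Context {R : realType} {H : hilbertType R} {I : choiceType}.
Variables (A : set I) (phi : I -> H).
Hypothesis hphi : orthonormal_basis A phi.

Definition proj (s : seq I) (x : H) : H :=
  \sum_(i <- s) inner (phi i) x *: phi i.

Definition coef_sq (x : H) (i : I) : R := normc (inner (phi i) x) ^+ 2.

Lemma inner_proj s x j : uniq s -> {in s, forall i, A i} -> j \in s ->
  inner (phi j) (proj s x) = inner (phi j) x.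
Proof.
move=> us sA js; rewrite inner_sumr (bigD1_seq j) //= innerZr.
rewrite (hphi.1 _ _ (sA _ js) (sA _ js)) eqxx mulr1.
rewrite big_seq_cond big1 ?addr0 // => i /andP[is_ ij].
by rewrite innerZr (hphi.1 _ _ (sA _ js) (sA _ is_)) eq_sym (negbTE ij) mulr0.
Qed.

Lemma inner_sub_proj s x s' (c : I -> R[i]) :
  uniq s -> {in s, forall i, A i} -> {subset s' <= s} ->
  inner (x - proj s x) (\sum_(i <- s') c i *: phi i) = 0.
Proof.
move=> us sA ss; rewrite inner_sumr big_seq big1 // => i /ss is_.
by rewrite innerZr innerC innerBr inner_proj // subrr conjc0 mulr0.
Qed.

Lemma sqnorm_proj s x : uniq s -> {in s, forall i, A i} ->
  sqnorm (proj s x) = \sum_(i <- s) coef_sq x i.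
Proof.
move=> us sA; rewrite /sqnorm {1}/proj inner_suml Re_sum !big_seq.
apply: eq_bigr => i is_.
by rewrite innerZl inner_proj // conj_mulE.
Qed.

Lemma sqnorm_sub_proj s x : uniq s -> {in s, forall i, A i} ->
  sqnorm (x - proj s x) = sqnorm x - \sum_(i <- s) coef_sq x i.
Proof.
move=> us sA; have -> : sqnorm x = sqnorm ((x - proj s x) + proj s x).
  by rewrite subrK.
have e : inner (x - proj s x) (proj s x) = 0 by exact: inner_sub_proj.
by rewrite [sqnorm (_ - _ + _)]sqnormD e sqnorm_proj //= mulr0 addr0 addrK.
Qed.

Lemma sqnorm_sub_proj_le s x s' (c : I -> R[i]) :
  uniq s -> {in s, forall i, A i} -> {subset s' <= s} ->
  sqnorm (x - proj s x) <= sqnorm (x - \sum_(i <- s') c i *: phi i).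
Proof.
move=> us sA ss; set v := \sum_(i <- s') _.
have -> : x - v = (x - proj s x) + (proj s x - v) by rewrite addrA subrK.
have e1 : inner (x - proj s x) (proj s x) = 0 by exact: inner_sub_proj.
have e2 : inner (x - proj s x) v = 0 by exact: inner_sub_proj.
rewrite [leRHS]sqnormD innerBr e1 e2 subrr /= mulr0 addr0.
by rewrite lerDl sqnorm_ge0.
Qed.

(** Parseval's identity in the form needed for sums over arbitrary index sets: any
    finite set of sites extends to one that captures all but [e] of
    the squared norm. *)
Lemma parseval_approx s x (e : R) : uniq s -> {in s, forall i, A i} -> 0 < e ->
  exists s', [/\ uniq (s ++ s'), {in s ++ s', forall i, A i} &
    sqnorm x - \sum_(i <- s ++ s') coef_sq x i <= e].
Proof.
move=> us sA e0; have [d [d0 de]] : exists d : R, 0 < d /\ d ^+ 2 <= e.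
  by exists (Num.sqrt e); rewrite sqrtr_gt0 e0 sqr_sqrtr // ltW.
have d0' : 0 < d%:C by rewrite ltcR.
have [v [vb [s1 [c [s1A vE]]]]] : ball x d%:C `&` [set x : H | exists (s : seq I)
    (c : I -> R[i]), (forall i, i \in s -> A i) /\
      x = \sum_(i <- s) c i *: phi i] !=set0.
  apply: hphi.2; first by exists x; exact: ballxx.
  exact: ball_open.
pose s' := [seq i <- undup s1 | i \notin s].
have us' : uniq (s ++ s').
  rewrite cat_uniq us filter_uniq ?undup_uniq // andbT.
  by apply/hasPn => i; rewrite mem_filter => /andP[].
have s'A : {in s ++ s', forall i, A i}.
  move=> i; rewrite mem_cat => /orP[/sA //|].
  by rewrite mem_filter mem_undup => /andP[_ /s1A].
exists s'; split => //; rewrite -sqnorm_sub_proj //.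
apply: le_trans (@sqnorm_sub_proj_le _ _ s1 c us' s'A _) _.
  move=> i is1; rewrite mem_cat mem_filter mem_undup is1 andbT.
  by rewrite orbN.
rewrite -vE; apply: le_trans de; rewrite -lecR -norm_sqnorm rmorphXn.
rewrite lerXn2r ?nnegrE ?normr_ge0 ?(ltW d0') //.
by apply: ltW; move: vb; rewrite -ball_normE.
Qed.

(** Split [z] into its part on the sites [s] and the rest. The first part meets [x]
    only through the components of [x] on [s]; the second is small when [z] has
    little mass outside [s]. So a vector [z] that keeps its overlap with [x] while
    [x] leaves [s] must itself have mass outside [s]. *)
Lemma overlap_le s x z : uniq s -> {in s, forall i, A i} ->
  normc (inner x z) ^+ 2 <=
  2 * (sqnorm z * \sum_(i <- s) coef_sq x i) +
  2 * (sqnorm x * (sqnorm z - \sum_(i <- s) coef_sq z i)).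
Proof.
move=> us sA; rewrite -sqnorm_sub_proj // -sqnorm_proj //.
have E : inner x z = inner (proj s x) z + inner x (z - proj s z).
  rewrite innerBr; suff -> : inner x (proj s z) = inner (proj s x) z.
    by rewrite addrC subrK.
  rewrite inner_sumr inner_suml; apply: eq_bigr => i _.
  by rewrite innerZr innerZl -innerC mulrC.
have c1 := cauchy_schwarz (proj s x) z.
have c2 := cauchy_schwarz x (z - proj s z).
rewrite E; set a := inner (proj s x) z in c1 *; set b := inner x _ in c2 *.
apply: (@le_trans _ _ ((normc a + normc b) ^+ 2)).
  by rewrite lerXn2r ?nnegrE ?addr_ge0 ?normc_ge0 // le_normcD.
have := sqr_ge0 (normc a - normc b); nra.
Qed.

(** All the mass outside [s] is counted with weight at least [W]. *)
Lemma esum_weight_ge s (w : I -> R) (W : R) x : uniq s ->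
  {in s, forall i, A i} -> 0 <= W ->
  (forall i, A i -> 0 <= w i) -> (forall i, A i -> i \notin s -> W <= w i) ->
  ((W * (sqnorm x - \sum_(i <- s) coef_sq x i))%:E <=
   \esum_(i in A) (w i * coef_sq x i)%:E)%E.
Proof.
move=> us sA W0 w0 wW; apply/lee_addgt0Pr => e e0.
have e1 : 0 < e / (W + 1) by rewrite divr_gt0 // ltr_wpDl.
have [s' [us' s'A hs']] := @parseval_approx s x _ us sA e1.
have := @esum_ge R I A (fun i => (w i * coef_sq x i)%:E).
move=> /(_ (\sum_(i \in [set` s ++ s']) (w i * coef_sq x i)%:E)%E) h.
have {}h := h (ex_intro2 _ _ [set` s ++ s'] (conj (finite_seq _) s'A) (lexx _)).
rewrite -leeBlDr //; apply: le_trans h.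
rewrite -fsbig_seq // sumEFin -EFinB lee_fin.
have c0 i : 0 <= coef_sq x i by exact: sqr_ge0.
rewrite !big_cat /= in hs' *.
have h1 : 0 <= \sum_(i <- s) w i * coef_sq x i.
  by rewrite big_seq sumr_ge0 // => i /sA /w0 wi; rewrite mulr_ge0.
have h2 : W * \sum_(i <- s') coef_sq x i <= \sum_(i <- s') w i * coef_sq x i.
  rewrite mulr_sumr big_seq [leRHS]big_seq; apply: ler_sum => i is_.
  apply: ler_wpM2r => //; apply: wW.
    by apply: s'A; rewrite mem_cat is_ orbT.
  move: us'; rewrite cat_uniq => /and3P[_ /hasPn + _]; exact.
have h3 : W * (e / (W + 1)) <= e.
  rewrite mulrA ler_pdivrMr ?ltr_wpDl // mulrC ler_wpM2l ?(ltW e0) //; lra.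
have := ler_wpM2l W0 hs'; nra.
Qed.

End orthonormal.

Section box.
Variable d : nat.

(** A cube around the ball of radius [N] for [index_norm]: its cardinal is immediate
    and has the same order in [N]. *)
Definition box (N : nat) : seq {ffun 'I_d -> int} :=
  [seq [ffun i => (f i : nat)%:Z - N%:Z] | f : {ffun 'I_d -> 'I_(2 * N).+1}].

Lemma box_uniq N : uniq (box N).
Proof.
rewrite map_inj_uniq ?enum_uniq // => f g /ffunP fg; apply/ffunP => i.
have := fg i; rewrite !ffunE => /addIr [] h; exact: val_inj.
Qed.

Lemma size_box N : size (box N) = ((2 * N).+1 ^ d)%N.
Proof. by rewrite size_map -cardE card_ffun !card_ord. Qed.

Lemma mem_box N n : (index_norm n <= N)%N -> n \in box N.
Proof.
move=> nN; have ni i : (`|n i| <= N)%N.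
  by apply: leq_trans nN; rewrite /index_norm (bigD1 i) //= leq_addr.
have lt i : (`|(n i + N%:Z)%R| < (2 * N).+1)%N by have := ni i; lia.
apply/mapP; exists [ffun i => Ordinal (lt i)]; first by rewrite mem_enum.
apply/ffunP => i; rewrite !ffunE /=; have := ni i; lia.
Qed.

End box.

(** * Averaged moments *)

Section asymptotics.
Context {R : realType}.

Lemma limn_einf_ge (u : nat -> \bar R) (x : \bar R) :
  (\forall n \near \oo, (x <= u n)%E) -> (x <= limn_einf u)%E.
Proof.
move=> [N _ hN]; rewrite limn_einf_lim; apply: lime_ge; first exact: is_cvg_einfs.
exists N => // n /= Nn; apply: le_ereal_inf_tmp => _ [k /= nk <-].
by apply: hN => /=; exact: leq_trans nk.
Qed.

(** Bernoulli's inequality for the square root [s] of [tau] bounds the linear factor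
    by a multiple of [s ^- j], and a factor [s ^+ j] is left. *)
Lemma linear_geometric_small (tau C e : R) : 0 < tau < 1 -> 0 <= C -> 0 < e ->
  \forall j \near \oo, C * ((j%:R + 3) * tau ^+ j) <= e.
Proof.
move=> /andP[t0 t1] C0 e0; pose s := Num.sqrt tau.
have s0 : 0 < s by rewrite sqrtr_gt0.
have s1 : s < 1 by rewrite -sqrtr1 ltr_sqrt.
have ss : tau = s * s by rewrite -expr2 sqr_sqrtr // ltW.
pose h := 1 - s; have h0 : 0 < h by rewrite subr_gt0.
have bern j : (1 + j%:R * h) * s ^+ j <= 1.
  elim: j => [|j IH]; first by rewrite mul0r addr0 expr0 mulr1.
  apply: le_trans IH; rewrite exprSr mulrA [_ * _ * s]mulrAC.
  rewrite ler_wpM2r ?exprn_ge0 ?(ltW s0) // -natr1.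
  have : 0 <= j%:R :> R by [].
  have -> : s = 1 - h by rewrite /h; ring.
  nra.
have bnd j : (j%:R + 3) * tau ^+ j <= 3 / h * s ^+ j.
  rewrite ss exprMn mulrA ler_wpM2r ?exprn_ge0 ?(ltW s0) //.
  rewrite ler_pdivlMr // mulrAC.
  apply: (@le_trans _ _ (3 * ((1 + j%:R * h) * s ^+ j))).
    rewrite mulrA ler_wpM2r ?exprn_ge0 ?(ltW s0) //.
    have : 0 <= j%:R :> R by [].
    have : h < 1 by rewrite /h; lra.
    nra.
  by rewrite -[leRHS]mulr1 ler_wpM2l.
have : (fun j => C * (3 / h) * s ^+ j) @ \oo --> (C * (3 / h) * 0 : R).
  by apply: cvgMr; apply: cvg_expr; rewrite ger0_norm // ltW.
rewrite mulr0 => /cvgr_lt /(_ _ e0); apply: filterS => j /ltW.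
by apply: le_trans; rewrite -mulrA ler_wpM2l.
Qed.

Lemma near_dyadic (P : nat -> nat -> Prop) :
  (\forall j \near \oo, forall K, (2 ^ j <= K < 2 ^ j.+1)%N -> P j K) ->
  \forall K \near \oo, exists j, (2 ^ j <= K < 2 ^ j.+1)%N /\ P j K.
Proof.
move=> [j0 _ h]; exists (2 ^ j0)%N => // K /= jK.
have K0 : (0 < K)%N by apply: leq_trans jK; rewrite expn_gt0.
have jb : (2 ^ trunc_log 2 K <= K < 2 ^ (trunc_log 2 K).+1)%N.
  exact: trunc_log_bounds.
exists (trunc_log 2 K); split => //; apply: h => //=.
exact: trunc_log_max.
Qed.

End asymptotics.

Section transport_bound.
Context {R : realType} {H : hilbertType R}.
Variables (U : H -> H) (d : nat) (A : set {ffun 'I_d -> int}).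
Variables (phi : {ffun 'I_d -> int} -> H) (psi : H).
Hypothesis hU : unitary U.
Hypothesis hphi : orthonormal_basis A phi.
Hypothesis psi1 : sqnorm psi = 1.

Lemma inner_iter k x z : inner (iter k U x) (iter k U z) = inner x z.
Proof. by case: hU => _ _ hi; elim: k => //= k IH; rewrite hi. Qed.

Lemma sqnorm_iter k x : sqnorm (iter k U x) = sqnorm x.
Proof. by rewrite /sqnorm inner_iter. Qed.

Variable p : R.

Definition weight (n : {ffun 'I_d -> int}) : R := (index_norm n)%:R `^ p + 1.

Lemma weight_ge0 n : 0 <= weight n.
Proof. by rewrite addr_ge0 // powR_ge0. Qed.

Lemma moment_ge s (W : R) k : uniq s -> {in s, forall i, A i} -> 0 <= W ->
  (forall n, A n -> n \notin s -> W <= weight n) ->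
  ((W * (1 - \sum_(n <- s) coef_sq phi (iter k U psi) n))%:E <=
     moment U A phi psi p k)%E.
Proof.
move=> us sA W0 wW; rewrite -psi1 -(sqnorm_iter k psi).
by apply: (esum_weight_ge _ _ hphi _ weight) => // n _; exact: weight_ge0.
Qed.

Lemma avg_moment_ge1 K : (0 < K)%N -> (1 <= avg_moment U A phi psi p K)%E.
Proof.
move=> K0; have m1 k : (1 <= moment U A phi psi p k)%E.
  have := @moment_ge [::] 1 k isT; rewrite big_nil subr0 mulr1; apply => //.
  by move=> n _ _; rewrite /weight lerDr powR_ge0.
rewrite /avg_moment.
apply: (@le_trans _ _ ((K%:R^-1)%:E * \sum_(0 <= k < K) (1 : \bar R))%E).
  rewrite sumEFin -EFinM lee_fin sumr_const_nat subn0.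
  by rewrite mulVf // pnatr_eq0 -lt0n.
by rewrite lee_wpmul2l ?lee_fin ?invr_ge0 //; apply: lee_sum => k _.
Qed.

(** The heart of the transport argument: the overlap of [iter k U x] and [iter k U psi]
    does not depend on [k] since [U] is unitary. By the bound [L] the former spends
    on average at most [L / K] on each site of [s]; if [s] is not too large, the
    latter keeps a fixed proportion of its mass outside [s], by [overlap_le]. *)
Lemma avg_moment_ge (x : H) s (W L : R) K : (0 < K)%N -> 0 < sqnorm x ->
  uniq s -> {in s, forall i, A i} -> 0 <= W ->
  (forall n, A n -> n \notin s -> W <= weight n) ->
  (forall z, \sum_(k < K) normc (inner z (iter k U x)) ^+ 2 <= L * sqnorm z) ->
  ((W * ((normc (inner x psi) ^+ 2 - 2 * (size s)%:R * (L / K%:R)) /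
      (2 * sqnorm x)))%:E <= avg_moment U A phi psi p K)%E.
Proof.
move=> K0 x0 us sA W0 wW hL.
pose r k := 1 - \sum_(n <- s) coef_sq phi (iter k U psi) n.
have KR : 0 < K%:R :> R by rewrite ltr0n.
rewrite /avg_moment.
apply: (@le_trans _ _ ((K%:R^-1)%:E * \sum_(0 <= k < K) (W * r k)%:E)%E); last first.
  rewrite lee_wpmul2l ?lee_fin ?invr_ge0 //.
  by apply: lee_sum => k _; exact: moment_ge.
rewrite sumEFin -EFinM lee_fin -mulr_sumr [leRHS]mulrCA ler_wpM2l //.
rewrite ler_pdivrMr ?mulr_gt0 // big_mkord.
have step k : normc (inner x psi) ^+ 2 <=
    2 * (\sum_(n <- s) coef_sq phi (iter k U x) n) + 2 * (sqnorm x * r k).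
  have := overlap_le _ _ hphi s (iter k U x) (iter k U psi) us sA.
  by rewrite inner_iter !sqnorm_iter psi1 mul1r.
have phi1 n : n \in s -> sqnorm (phi n) = 1.
  by move=> /sA An; rewrite /sqnorm hphi.1 // eqxx.
have T : \sum_(k < K) normc (inner x psi) ^+ 2 <=
   2 * ((size s)%:R * L) + 2 * (sqnorm x * \sum_(k < K) r k).
  apply: le_trans (ler_sum _ (fun (k : 'I_K) _ => step k)) _.
  rewrite big_split /= -!mulr_sumr lerD2r ler_wpM2l // exchange_big /=.
  apply: (@le_trans _ _ (\sum_(n <- s) L)); last first.
    by rewrite big_const_seq count_predT iter_addr_0 mulr_natl.
  rewrite big_seq [leRHS]big_seq; apply: ler_sum => n ns.
  by have := hL (phi n); rewrite phi1 // mulr1.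
rewrite sumr_const card_ord -[leLHS]mulr_natl in T.
rewrite -(ler_pM2l KR); set Sr := \sum_(k < K) r k in T *.
have -> : K%:R * (K%:R^-1 * Sr * (2 * sqnorm x)) = 2 * (sqnorm x * Sr).
  by field; rewrite gt_eqF.
have -> : K%:R * (normc (inner x psi) ^+ 2 - 2 * (size s)%:R * (L / K%:R)) =
   K%:R * normc (inner x psi) ^+ 2 - 2 * ((size s)%:R * L).
  by field; rewrite gt_eqF.
by rewrite lerBlDl.
Qed.

End transport_bound.

(** * The transport exponent *)

Section exponent.
Context {R : realType} {H : hilbertType R}.
Variables (U : H -> H) (d : nat) (A : set {ffun 'I_d -> int}).
Variables (phi : {ffun 'I_d -> int} -> H) (psi : H).
Hypothesis hU : unitary U.
Hypothesis hphi : orthonormal_basis A phi.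
Hypothesis psi1 : sqnorm psi = 1.
Variable p : R.
Hypothesis p0 : 0 < p.

Lemma le_lne_div (v : \bar R) (r l : R) : 0 < l -> ((expR (r * l))%:E <= v)%E ->
  (r%:E <= lne v * (l^-1)%:E)%E.
Proof.
move=> l0 hv; have -> : r%:E = ((r * l)%:E * (l^-1)%:E)%E.
  by rewrite -EFinM mulfK // gt_eqF.
rewrite lee_wpmul2r ?lee_fin ?invr_ge0 ?(ltW l0) //.
rewrite -[r * l](expRK (r * l)) -lne_EFin ?expR_gt0 //.
have e0 : (0 <= (expR (r * l))%:E)%E by rewrite lee_fin expR_ge0.
by rewrite lee_lne // in_itv /= leey andbT // (le_trans e0).
Qed.

(** Apply [avg_moment_ge] to a box of radius about [X = 2 `^ (j * b)] at times of
    order [2 ^ j]. It has about [X ^+ d] sites, so the average mass of [iter k U x] in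
    it is of order [(j + 3) * tau ^+ j] with [tau = 2 `^ (b * d) * theta < 1], hence
    negligible; the averaged moments are then at least a constant times [X `^ p].
    The constant costs an arbitrarily small part of the exponent, whence [r < b]. *)
Lemma beta_lower_ge_of_sieve (x : H) (theta r b : R) (J : nat) :
  inner x psi != 0 -> 0 < r -> r < b -> 2 `^ (b * d%:R) * theta < 1 -> 0 < theta ->
  (forall j K, (J <= j)%N -> (K <= 2 * 2 ^ j)%N -> forall z,
    \sum_(k < K) normc (inner z (iter k U x)) ^+ 2 <=
    128 * 2 ^+ j * (j%:R + 3) * theta ^+ j * sqnorm z) ->
  (r%:E <= beta_lower U A phi psi p)%E.
Proof.
move=> xpsi r0 rb tau1 th0 hsieve.
have x0 : 0 < sqnorm x.
  by apply: sqnorm_gt0; apply: contraNneq xpsi => ->; rewrite inner0l.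
set c2 := normc (inner x psi) ^+ 2.
have c20 : 0 < c2.
  rewrite exprn_gt0 // lt_def normc_ge0 andbT.
  by apply: contraNneq xpsi => h; apply/eqP; exact: eq0_normc.
pose tau := 2 `^ (b * d%:R) * theta.
have t01 : 0 < tau < 1 by rewrite tau1 andbT mulr_gt0 // powR_gt0.
pose c1 := c2 / (4 * sqnorm x).
have c10 : 0 < c1 by rewrite divr_gt0 // mulr_gt0.
have ln2 : 0 < ln 2 :> R by rewrite ln_gt0 //; lra.
have b0 : 0 < b by exact: lt_trans rb.
apply: limn_einf_ge.
suff h : \forall j \near \oo, forall K, (2 ^ j <= K < 2 ^ j.+1)%N ->
    (r%:E <= lne (avg_moment U A phi psi p K) * ((p * ln K%:R)^-1)%:E)%E.
  have := near_dyadic (fun _ K => (r%:E <= lne (avg_moment U A phi psi p K) *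
    ((p * ln K%:R)^-1)%:E)%E) h.
  by apply: filterS => K [j []].
have C0 : 0 <= 2 * 3 ^+ d * 128 :> R by rewrite !mulr_ge0 ?exprn_ge0.
have E1 := @linear_geometric_small R tau _ (c2 / 2) t01 C0 (divr_gt0 c20 (ltr0n _ 2)).
have E2 : \forall j \near \oo, r * p * ln 2 - ln c1 <= j%:R * (p * ln 2 * (b - r)).
  have q0 : 0 < p * ln 2 * (b - r) by rewrite !mulr_gt0 ?subr_gt0.
  have := nbhs_infty_ger ((r * p * ln 2 - ln c1) / (p * ln 2 * (b - r))).
  by apply: filterS => j; rewrite ler_pdivrMr.
have E3 : \forall j \near \oo, (J <= j)%N by exists J.
have E4 : \forall j \near \oo, (1 <= j)%N by exists 1%N.
near=> j => K /andP[jK Kj].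
have K2 : (2 <= K)%N.
  apply: leq_trans jK; rewrite -{1}(expn1 2) leq_exp2l //.
  by near: j.
have K1 : (0 < K)%N by exact: ltnW.
have lnK_gt0 : 0 < ln K%:R :> R by rewrite ln_gt0 // ltr1n.
apply: le_lne_div; first exact: mulr_gt0.
(* radius of the box at time scale [2 ^ j] *)
pose X : R := 2 `^ (j%:R * b).
have X1 : 1 <= X.
  have h2 : 1 <= 2 :> R by lra.
  have := @ler_powR R 2 h2 0 (j%:R * b); rewrite powRr0; apply.
  by rewrite mulr_ge0 // ltW.
have X0 : 0 < X by exact: lt_le_trans X1.
pose N := Num.truncn X.
have /andP[NX XN] := truncn_itv (ltW X0).
rewrite -/N in NX XN.
pose s := [seq n <- box d N | `[< A n >]].
have us : uniq s by rewrite filter_uniq // box_uniq.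
have sA : {in s, forall n, A n} by move=> n; rewrite mem_filter => /andP[/asboolP].
have ss : (size s)%:R <= (3 * X) ^+ d.
  apply: (@le_trans _ _ (((2 * N).+1 ^ d)%:R)).
    by rewrite ler_nat -size_box size_filter count_size.
  rewrite natrX lerXn2r ?nnegrE // ?mulr_ge0 // ?(ltW X0) //.
  by rewrite -addn1 natrD natrM; lra.
have W0 : 0 <= X `^ p by exact: powR_ge0.
have wW n : A n -> n \notin s -> X `^ p <= weight d p n.
  move=> An ns; rewrite /weight -[leLHS]addr0; apply: lerD => //.
  apply: ge0_ler_powR; rewrite ?nnegrE ?(ltW X0) ?(ltW p0) //.
  apply: (le_trans (ltW XN)); rewrite ler_nat ltnNge.
  apply: contra ns => /mem_box nb; rewrite mem_filter nb andbT.
  exact/asboolP.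
have Jj : (J <= j)%N by near: j.
have KK : (K <= 2 * 2 ^ j)%N by rewrite -expnS ltnW.
apply: le_trans (avg_moment_ge _ _ _ _ _ hU hphi psi1 p x s (X `^ p) _ K K1 x0
  us sA W0 wW (hsieve _ _ Jj KK)).
rewrite lee_fin -/c2.
have small : 2 * (size s)%:R * (128 * 2 ^+ j * (j%:R + 3) * theta ^+ j / K%:R) <= c2 / 2.
  apply: (@le_trans _ _ (2 * (3 * X) ^+ d * (128 * (j%:R + 3) * theta ^+ j))).
    apply: ler_pM; rewrite ?mulr_ge0 ?invr_ge0 ?exprn_ge0 ?(ltW th0) //.
      by rewrite ler_wpM2l.
    rewrite ler_pdivrMr ?ltr0n //.
    have : 2 ^+ j <= K%:R :> R by rewrite -natrX ler_nat.
    have q : 0 <= 128 * (j%:R + 3) * theta ^+ j.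
      by rewrite !mulr_ge0 ?exprn_ge0 ?(ltW th0).
    move=> /(ler_wpM2l q); apply: le_trans.
    by rewrite le_eqVlt; apply/orP; left; apply/eqP; ring.
  have -> : 2 * (3 * X) ^+ d * (128 * (j%:R + 3) * theta ^+ j) =
      2 * 3 ^+ d * 128 * ((j%:R + 3) * tau ^+ j).
    have -> : tau ^+ j = X ^+ d * theta ^+ j.
      rewrite /tau exprMn; congr (_ * _).
      have <- : (2 `^ (b * d%:R)) `^ j%:R = (2 `^ (b * d%:R)) ^+ j.
        by rewrite powR_mulrn // powR_ge0.
      have <- : X `^ d%:R = X ^+ d by rewrite powR_mulrn // ltW.
      rewrite -(powRrM 2 (b * d%:R)) /X -(powRrM 2 (j%:R * b)).
      by congr (_ `^ _); ring.
    rewrite exprMn; ring.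
  by near: j.
apply: (@le_trans _ _ (X `^ p * c1)); last first.
  rewrite ler_wpM2l //.
  have -> : c1 = (c2 / 2) / (2 * sqnorm x) by rewrite /c1; field; rewrite gt_eqF.
  by rewrite ler_wpM2r ?invr_ge0 ?mulr_ge0 ?(ltW x0) //; lra.
have Xp0 : 0 < X `^ p by exact: powR_gt0.
have -> : X `^ p * c1 = expR (ln (X `^ p * c1)) by rewrite lnK // posrE mulr_gt0.
rewrite ler_expR.
rewrite lnM ?posrE ?powR_gt0 // ln_powR /X ln_powR.
apply: (@le_trans _ _ (r * (p * (j.+1%:R * ln 2)))).
  rewrite !ler_wpM2l ?(ltW r0) ?(ltW p0) // -ln_powR powR_mulrn //.
  rewrite ler_ln ?posrE ?ltr0n ?exprn_gt0 // -natrX ler_nat; exact: ltnW.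
rewrite -natr1; have : r * p * ln 2 - ln c1 <= j%:R * (p * ln 2 * (b - r)) by near: j.
lra.
Unshelve. all: by end_near. Qed.

End exponent.

(** By Parseval every moment is at least 1, so its logarithm is nonnegative. *)
Lemma beta_lower_ge0 (R : realType) (H : hilbertType R)
    (U : H -> H) (hU : unitary U) (psi : H) (psi1 : sqnorm psi = 1)
    (d : nat) (A : set {ffun 'I_d -> int})
    (phi : {ffun 'I_d -> int} -> H) (hphi : orthonormal_basis A phi)
    (p : R) (p0 : 0 < p) :
  (0 <= beta_lower U A phi psi p)%E.
Proof.
apply: limn_einf_ge; exists 1%N => // K /= K0.
apply: mule_ge0; first by rewrite lne_ge0; exact: avg_moment_ge1.
by rewrite lee_fin invr_ge0 mulr_ge0 ?(ltW p0) // ln_ge0 // ler1n.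
Qed.

(** The vector is the restriction of [y] to the spectral set of [large_regular_set].
    The mass left out is less than [sqnorm y ^+ 2], so the restriction is too close to
    [y] to be orthogonal to [psi]: the overlap of [y] with [psi] is [sqnorm y], since
    [psi - y] is orthogonal to [y]. *)
Lemma regular_vector (R : realType) (H : hilbertType R)
    (U : H -> H) (psi y : H) (psi1 : sqnorm psi = 1) (alpha theta : R) :
  0 <= alpha -> 0 < theta -> 2 `^ (- alpha) < theta ->
  H_ac U alpha y -> y != 0 -> inner y (psi - y) = 0 ->
  exists (x : H) (J : nat), inner x psi != 0 /\
  forall j K, (J <= j)%N -> (K <= 2 * 2 ^ j)%N -> forall z,
    \sum_(k < K) normc (inner z (iter k U x)) ^+ 2 <=
    128 * 2 ^+ j * (j%:R + 3) * theta ^+ j * sqnorm z.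
Proof.
move=> a0 th0 ath [mu [[F [calc spec]] ac]] y0 yorth.
have ny : 0 < sqnorm y by exact: sqnorm_gt0.
have e0 : 0 < sqnorm y ^+ 2 by rewrite exprn_gt0.
have [S [J [mS muS hS]]] := large_regular_set mu _ _ _ ac a0 th0 ath e0.
exists (F (cindic S) y), J; split; last first.
  move=> j K Jj KK; apply: (spectral_sieve _ _ calc _ _ spec) => //.
    by rewrite exprn_ge0 // ltW.
  by move=> z Sz; exact: hS.
rewrite -(sqnorm_calculus_indic_compl _ _ calc _ _ spec) // lte_fin in muS.
apply: contraTneq muS => x0; rewrite -leNgt.
have := cauchy_schwarz (y - F (cindic S) y) psi.
rewrite psi1 mulr1 innerBl x0 subr0.
have -> : inner y psi = inner y y.
  by rewrite -[psi in LHS](subrK y) innerDr yorth add0r.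
rewrite innerxx; apply: le_trans.
by rewrite normc_sqrE expr0n addr0.
Qed.

Theorem corollary3p11 (R : realType) (H : hilbertType R)
    (hsep : separable H)
    (U : H -> H) (hU : unitary U)
    (psi : H) (hpsi : `|psi| = 1)
    (d : nat) (hd : (1 <= d)%N)
    (A : set {ffun 'I_d -> int}) (hA : A = pos_lattice d \/ A = setT)
    (phi : {ffun 'I_d -> int} -> H) (hphi : orthonormal_basis A phi)
    (alpha : R) (halpha : 0 <= alpha <= 1)
    (hac : P_ac U alpha psi != 0)
    (p : R) (hp : 0 < p) :
  ((alpha / d%:R)%:E <= beta_lower U A phi psi p)%E.
Proof.
have psi1 : sqnorm psi = 1.
  by apply: complexI; rewrite -norm_sqnorm hpsi expr1n.
have [y [Hy y0 yorth]] :
    exists y, [/\ H_ac U alpha y, y != 0 & inner y (psi - y) = 0].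
  move: hac; rewrite /P_ac /orth_proj; case: xgetP => [y _ [Hy hy] y0|_].
    by eexists; split; [exact: Hy | exact: y0 | exact: hy].
  by rewrite eqxx.
have d0 : 0 < d%:R :> R by rewrite ltr0n.
have /andP[a0 _] := halpha.
apply/lee_subgt0Pr => e e0; rewrite -EFinB; set r := _ - e.
have [r0|r0] := leP r 0.
  by apply: (@le_trans _ _ 0%E); [rewrite lee_fin | exact: beta_lower_ge0].
(* three strict inequalities are needed: [r < b] to absorb constants, [b * d < a] to
   absorb the factor [j + 3], and [a < alpha] to find light cells *)
pose b := r + e / 3; pose a := (r + 2 * e / 3) * d%:R.
have aalpha : a < alpha.
  by rewrite -ltr_pdivlMr // /r; lra.
have pow_lt u v : u < v -> 2 `^ u < 2 `^ v :> R.
  move=> uv; rewrite /powR !ifF; last 2 first.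
  - by apply/negbTE; rewrite pnatr_eq0.
  - by apply/negbTE; rewrite pnatr_eq0.
  by rewrite ltr_expR ltr_pM2r // ln_gt0 // ltr1n.
have ath : 2 `^ (- alpha) < 2 `^ (- a) by apply: pow_lt; rewrite ltrN2.
have [x [J [xpsi hx]]] :=
  regular_vector _ _ U psi y psi1 alpha _ a0 (powR_gt0 _ (ltr0n _ 2)) ath Hy y0 yorth.
apply: (beta_lower_ge_of_sieve _ _ _ _ _ hU hphi psi1 p hp x (2 `^ (- a)) r b J) => //.
- by rewrite /b ltrDl divr_gt0.
- rewrite -powRD; last by rewrite pnatr_eq0 implybT.
  have := pow_lt (b * d%:R - a) 0; rewrite powRr0; apply.
  by rewrite -mulrBl pmulr_llt0 // /b; lra.
Qed.
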